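(* Let $S$ be a locally compact Hausdorff semitopological semigroup with identity which is semifoundation. Then the following statements are equivalent: (1) $M(S)^*$ has a topologically left invariant mean; (2) for all $n \in \mathbb{N}$ and $\mu_1, \ldots, \mu_n \in M(S)$, $$\inf\bigl\{ \sup\{ \|\mu_i * \mu\| : 1 \le i \le n\} : \mu \in M_0(S)\bigr\} \le \sup\{ |\mu_i(S)| : 1 \le i \le n\}.$$
   Context: A semitopological semigroup is a semigroup with a topology in which multiplication is separately continuous. $M(S)$ is the Banach algebra of all bounded regular (complex) Borel measures on $S$ with total variation norm $\|\cdot\|$ and convolution $*$ as multiplication, where $\int g\, d(\mu*\nu) = \int\int g(xy)\, d\mu(x)\, d\nu(y)$ for $g \in C_0(S)$. $M_0(S)$ is the set of probability measures in $M(S)$, and $\delta_x$ is the point mass at $x$. $M(S)^*$ and $M(S)^{**}$ are the first and second Banach space duals. For $f \in M(S)^*$ and $\mu \in M(S)$, the functional $f\mu \in M(S)^*$ is defined by $\langle f\mu, \lambda\rangle = \langle f, \mu * \lambda\rangle$ for $\lambda \in M(S)$. The element $1 \in M(S)^*$ is defined by $\langle 1, \mu\rangle = \mu(S)$. For $f\in M(S)^*$, $f \ge 0$ means $\langle f,\mu\rangle \ge 0$ for every positive measure $\mu \in M(S)$. A linear functional $M \in M(S)^{**}$ is a mean (on $M(S)^*$) if $\langle M, f\rangle \ge 0$ whenever $f \ge 0$, and $\langle M, 1\rangle = 1$. A mean $M$ is topologically left invariant if $\langle M, f\mu\rangle = \langle M, f\rangle$ for all $\mu \in M_0(S)$ and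 $f \in M(S)^*$. $S$ is called semifoundation if there is a measure $\nu \in M_0(S)$ such that the map $x \mapsto \delta_x * \nu$ from $S$ into $M(S)$ (with the norm topology) is continuous. *)

(* Defs.v *)
(* MathComp-Analysis, over an abstract [R : realType]; scalars are [R[i]]. *)
From HB Require Import structures.
From mathcomp Require Import all_boot all_order all_algebra.
From mathcomp Require Import all_classical all_reals all_analysis.
From mathcomp Require Import complex.

Set Implicit Arguments.
Unset Strict Implicit.
Unset Printing Implicit Defensive.

Import Order.TTheory GRing.Theory Num.Theory.
Import numFieldNormedType.Exports.

Local Open Scope classical_set_scope.
Local Open Scope ring_scope.

Notation Re := complex.Re.
Notation Im := complex.Im.
Notation normc := ComplexField.Normc.normc.

(* The base point of a [ptopologicalType] plays no role: it is there because
   [measurableType] asks for one. *)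
Definition borel (S : ptopologicalType) := g_sigma_algebraType (@open S).
HB.instance Definition _ (S : ptopologicalType) := Measurable.on (borel S).

Section complex_measures.
Context {R : realType} {S : ptopologicalType}.
Implicit Type m : set S -> R[i].

Definition is_borel (A : set S) : Prop := measurable (A : set (borel S)).

(* [R[i]] carries no topology in the libraries, hence countable additivity is
   stated for the real and the imaginary part separately. *)
Definition repart m : set (borel S) -> \bar R := fun A => (Re (m A))%:E.
Definition impart m : set (borel S) -> \bar R := fun A => (Im (m A))%:E.

Definition tvar m (A : set S) : \bar R :=
  ereal_sup [set s | exists n (F : 'I_n -> set S),
    [/\ forall i, is_borel (F i), forall i, F i `<=` A, trivIset setT F &
        s = (\sum_(i < n) normc (m (F i)))%:E]].

Definition is_regular m := forall (A : set S) (eps : R), is_borel A -> 0 < eps ->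
  exists K U, [/\ compact K, open U, K `<=` A, A `<=` U &
                  (tvar m (U `\` K) < eps%:E)%E].

(* A measure is a function on all subsets of [S]; giving it the value 0 off the
   Borel sets makes equality of measures the Leibniz equality. *)
Definition is_cmeasure m :=
  [/\ forall A, ~ is_borel A -> m A = 0, m set0 = 0,
      semi_sigma_additive (repart m), semi_sigma_additive (impart m) &
      is_regular m].

End complex_measures.

Definition cmeasure_pred (R : realType) (S : ptopologicalType) :
  {pred (set S -> R[i])} := [pred m | `[< is_cmeasure m >]].
Arguments cmeasure_pred : clear implicits.

Section is_cmeasure_lin.
Context {R : realType} {S : ptopologicalType}.
Implicit Types m : set S -> R[i].

Lemma repart0 m : is_cmeasure m -> repart m set0 = 0%E.
Proof. by rewrite /repart => -[_ -> _ _ _]. Qed.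

Lemma impart0 m : is_cmeasure m -> impart m set0 = 0%E.
Proof. by rewrite /impart => -[_ -> _ _ _]. Qed.

Lemma repart_semi_sigma_additive m : is_cmeasure m -> semi_sigma_additive (repart m).
Proof. by case. Qed.

Lemma impart_semi_sigma_additive m : is_cmeasure m -> semi_sigma_additive (impart m).
Proof. by case. Qed.

Definition recharge m (hm : is_cmeasure m) : {charge set (borel S) -> \bar R} :=
  HB.pack (repart m) (isCharge.Build _ (borel S) R (repart m)
    (repart0 hm) (fun _ _ => isT) (repart_semi_sigma_additive hm)).

Definition imcharge m (hm : is_cmeasure m) : {charge set (borel S) -> \bar R} :=
  HB.pack (impart m) (isCharge.Build _ (borel S) R (impart m)
    (impart0 hm) (fun _ _ => isT) (impart_semi_sigma_additive hm)).

Lemma tvar_subset m (A B : set S) : A `<=` B -> (tvar m A <= tvar m B)%E.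
Proof.
move=> AB; apply: ge_ereal_sup => _ [n [F [mF FA tF ->]]].
apply: ereal_sup_ubound; exists n, F; split => // i; exact: subset_trans AB.
Qed.

Lemma tvar_ge0 m (A : set S) : (0 <= tvar m A)%E.
Proof.
apply: ereal_sup_ubound; exists 0%N, (fun=> set0); split => //.
- by case.
- by case.
- by case.
- by rewrite big_ord0.
Qed.

Lemma tvar_lin (a : R[i]) m1 m2 (A : set S) :
  (tvar (a *: m1 + m2)%R A <= (normc a)%:E * tvar m1 A + tvar m2 A)%E.
Proof.
have na : 0 <= normc a by rewrite /normc; case: (a) => x y; exact: sqrtr_ge0.
apply: ge_ereal_sup => _ [n [F [mF FA tF ->]]].
apply: (@le_trans _ _ ((normc a)%:E * (\sum_(i < n) normc (m1 (F i)))%:E +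
   (\sum_(i < n) normc (m2 (F i)))%:E)%E).
  rewrite -EFinM -EFinD lee_fin mulr_sumr -big_split/=; apply: ler_sum => i _.
  rewrite -ComplexField.Normc.normcM; exact: le_normcD.
apply: leeD; first apply: lee_wpmul2l; rewrite ?lee_fin//.
  by apply: ereal_sup_ubound; exists n, F.
by apply: ereal_sup_ubound; exists n, F.
Qed.

Lemma is_cmeasure0 : is_cmeasure (0 : set S -> R[i]).
Proof.
have tv0 (A : set S) : tvar (0 : set S -> R[i]) A = 0%E.
  apply/eqP; rewrite eq_le tvar_ge0 andbT; apply: ge_ereal_sup.
  move=> _ [n [F [_ _ _ ->]]]; rewrite big1// => i _.
  exact: ComplexField.Normc.normc0.
split => //.
- move=> F _ _ _; rewrite [X in X @ _ --> _](_ : _ = fun=> 0%E); first exact: cvg_cst.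
  by apply/funext => n; rewrite big1.
- move=> F _ _ _; rewrite [X in X @ _ --> _](_ : _ = fun=> 0%E); first exact: cvg_cst.
  by apply/funext => n; rewrite big1.
- move=> A e _ e0; exists set0, setT; split => //.
  + exact: compact0.
  + exact: openT.
  + by rewrite tv0 lte_fin.
Qed.

Lemma is_cmeasure_lin (a : R[i]) m1 m2 :
  is_cmeasure m1 -> is_cmeasure m2 -> is_cmeasure (a *: m1 + m2).
Proof.
move=> h1 h2.
pose r1 := recharge h1; pose i1 := imcharge h1.
pose r2 := recharge h2; pose i2 := imcharge h2.
case: (h1) (h2) => [s1 z1 _ _ g1] [s2 z2 _ _ g2].
have na : 0 <= normc a by rewrite /normc; case: (a) => x y; exact: sqrtr_ge0.
split.
- by move=> A nA; rewrite /= !fctE s1// s2// scaler0 addr0.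
- by rewrite /= !fctE z1 z2 scaler0 addr0.
- have -> : repart (a *: m1 + m2) =
     cadd (cadd (cscale (Re a) r1) (cscale (- Im a) i1)) r2.
    apply/funext => A; rewrite /cadd/= /cadd/= /cscale/= /impart /repart !fctE.
    case: (a) (m1 A) (m2 A) => [p q] [b c] [d f] /=.
    by rewrite -!EFinM -!EFinD mulNr.
  exact: charge_semi_sigma_additive.
- have -> : impart (a *: m1 + m2) =
     cadd (cadd (cscale (Re a) i1) (cscale (Im a) r1)) i2.
    apply/funext => A; rewrite /cadd/= /cadd/= /cscale/= /impart /repart !fctE.
    case: (a) (m1 A) (m2 A) => [p q] [b c] [d f] /=.
    by rewrite -!EFinM -!EFinD.
  exact: charge_semi_sigma_additive.
- move=> A e mA e0.
  have c0 : 0 < normc a + 1 by rewrite ltr_wpDl.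
  have e2 : 0 < e / 2 by rewrite divr_gt0.
  have [|K1 [U1 [cK1 oU1 KA1 AU1 t1]]] := g1 A (e / 2 / (normc a + 1)) mA.
    by rewrite divr_gt0.
  have [K2 [U2 [cK2 oU2 KA2 AU2 t2]]] := g2 A (e / 2) mA e2.
  exists (K1 `|` K2), (U1 `&` U2); split.
  + exact: compactU.
  + exact: openI.
  + by rewrite subUset.
  + by rewrite subsetI.
  set D := _ `\` _.
  have D1 : (tvar m1 D <= (e / 2 / (normc a + 1))%:E)%E.
    apply: le_trans (ltW t1); apply: tvar_subset => x [[? ?] nK].
    by split=> // ?; apply: nK; left.
  have D2 : (tvar m2 D < (e / 2)%:E)%E.
    apply: le_lt_trans t2; apply: tvar_subset => x [[? ?] nK].
    by split=> // ?; apply: nK; right.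
  have aD1 : ((normc a)%:E * tvar m1 D <= (e / 2)%:E)%E.
    apply: (@le_trans _ _ ((normc a)%:E * (e / 2 / (normc a + 1))%:E)%E).
      by apply: lee_wpmul2l => //; rewrite lee_fin.
    rewrite -EFinM lee_fin mulrCA -[leRHS]mulr1; apply: ler_wpM2l; first exact: ltW.
    by rewrite ler_pdivrMr// mul1r lerDl.
  apply: le_lt_trans (tvar_lin _ _ _ _) _.
  apply: (@le_lt_trans _ _ ((e / 2)%:E + tvar m2 D)%E); first exact: leeD2r.
  by rewrite [X in (_ < X%:E)%E](splitr e) EFinD lteD2lE.
Qed.

Lemma cmeasure_pred_submod : submod_closed (cmeasure_pred R S).
Proof.
split; first by rewrite inE; exact: is_cmeasure0.
move=> a u v; rewrite !inE => hu hv; exact: is_cmeasure_lin.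
Qed.

HB.instance Definition _ :=
  GRing.isSubmodClosed.Build R[i] (set S -> R[i]) (cmeasure_pred R S)
    cmeasure_pred_submod.

End is_cmeasure_lin.

(* The space M(S) of bounded regular complex Borel measures, a vector space
   for the pointwise operations. *)
Record cmeasure (R : realType) (S : ptopologicalType) := CMeasure {
  cmeasure_val :> set S -> R[i] ;
  _ : cmeasure_val \in cmeasure_pred R S }.

Section cmeasure_lmod.
Context {R : realType} {S : ptopologicalType}.
HB.instance Definition _ := [isSub for @cmeasure_val R S].
HB.instance Definition _ := [Choice of cmeasure R S by <:].
HB.instance Definition _ := [SubChoice_isSubLmodule of cmeasure R S by <:].

Lemma cmeasureP (mu : cmeasure R S) : is_cmeasure mu.
Proof. by case: mu => m /=; rewrite inE. Qed.

End cmeasure_lmod.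

Section convolution.
Context {R : realType} {S : ptopologicalType}.
Implicit Types mu nu lambda : cmeasure R S.

Definition tvnorm mu : R := fine (tvar mu setT).

Definition positive_measure mu := forall A, is_borel A -> 0 <= mu A.

Definition M0 : set (cmeasure R S) :=
  [set mu | positive_measure mu /\ mu setT = 1].

(* Integral against a signed measure, through its Jordan decomposition, which
   does not depend on the Hahn decomposition that is picked. *)
Definition charge_integral (nu : {charge set (borel S) -> \bar R})
    (f : S -> R) : R :=
  let PN := projT2 (cid (projT2 (cid (Hahn_decomposition nu)))) in
  Rintegral (jordan_pos PN) setT f - Rintegral (jordan_neg PN) setT f.

Definition cintegral mu (f : S -> R[i]) : R[i] :=
  let re := recharge (cmeasureP mu) in
  let im := imcharge (cmeasureP mu) in
  Complex
    (charge_integral re (fun x => Re (f x)) - charge_integral im (fun x => Im (f x)))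
    (charge_integral re (fun x => Im (f x)) + charge_integral im (fun x => Re (f x))).

Definition C0 : set (S -> R[i]) :=
  [set g | [/\ continuous (fun x => Re (g x)), continuous (fun x => Im (g x)) &
    forall eps : R, 0 < eps -> compact [set x | eps <= normc (g x)]]].

(* The measure [measure_conv mul mu nu] exists and is unique when [mul] is separately
   continuous and [S] is locally compact Hausdorff (Riesz representation); the
   default value 0 is never used in that case. *)
Definition measure_conv (mul : S -> S -> S) mu nu : cmeasure R S :=
  xget 0 [set lambda | forall g, C0 g -> cintegral lambda g =
    cintegral nu (fun y => cintegral mu (fun x => g (mul x y)))].

End convolution.

Section dirac.
Context (R : realType) {S : ptopologicalType}.

Definition dirac_fun (x : S) (A : set S) : R[i] :=
  if `[< is_borel A /\ A x >] then 1 else 0.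

Lemma is_cmeasure_dirac (hS : hausdorff_space S) (x : S) :
  is_cmeasure (dirac_fun x).
Proof.
have E (A : set S) : is_borel A -> repart (dirac_fun x) A = \d_(x : borel S) A.
  move=> mA; rewrite /repart /dirac_fun diracE; case: asboolP => [[_ Ax]|nA].
    by rewrite mem_set.
  by rewrite memNset// => Ax; apply: nA.
have E0 (A : set S) : impart (dirac_fun x) A = 0%E.
  by rewrite /impart /dirac_fun; case: ifP.
have tv (A : set S) : ~ A x -> tvar (dirac_fun x) A = 0%E.
  move=> nAx; apply/eqP; rewrite eq_le tvar_ge0 andbT; apply: ge_ereal_sup.
  move=> _ [n [F [_ FA _ ->]]]; rewrite big1// => i _.
  rewrite /dirac_fun asboolF; first exact: ComplexField.Normc.normc0.
  by move=> [_ /FA].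
split.
- by move=> A nA; rewrite /dirac_fun asboolF// => -[].
- by rewrite /dirac_fun asboolF// => -[].
- move=> F mF tF mUF; rewrite E//.
  rewrite [X in X @ _ --> _](_ : _ =
    fun n => (\sum_(0 <= i < n) (\d_(x : borel S) : {measure set (borel S) -> \bar R}) (F i))%E).
    exact: measure_semi_sigma_additive.
  by apply/funext => n; apply: eq_bigr => i _; rewrite E; last exact: mF.
- move=> F _ _ _; rewrite E0 [X in X @ _ --> _](_ : _ = fun=> 0%E).
    exact: cvg_cst.
  by apply/funext => n; rewrite big1.
- move=> A e mA e0; have [Ax|nAx] := pselect (A x).
    exists [set x], setT; split => //.
    + exact: compact_set1.
    + exact: openT.
    + by move=> _ ->.
    + by rewrite tv ?lte_fin// => -[_]; apply.
  exists set0, (~` [set x]); split => //.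
  + exact: compact0.
  + by apply: closed_openC; apply: accessible_closed_set1; exact: hausdorff_accessible.
  + by move=> y Ay /= yx; apply: nAx; rewrite -yx.
  + by rewrite tv ?lte_fin// => -[/= nx _]; apply: nx.
Qed.

Lemma dirac_fun_in (hS : hausdorff_space S) (x : S) :
  dirac_fun x \in cmeasure_pred R S.
Proof. by rewrite inE; exact: is_cmeasure_dirac. Qed.

Definition point_mass (hS : hausdorff_space S) (x : S) : cmeasure R S :=
  CMeasure (dirac_fun_in hS x).

End dirac.

Section duality.
Context {R : realType} {S : ptopologicalType}.
Implicit Types (mu nu lambda : cmeasure R S) (f g : cmeasure R S -> R[i]).

(* M(S)^* as a set of functions on M(S). *)
Definition Mdual : set (cmeasure R S -> R[i]) :=
  [set f | scalar f /\
    exists C : R, forall mu, normc (f mu) <= C * tvnorm mu].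

Definition Mdual_norm f : R :=
  sup [set normc (f mu) | mu in [set mu | tvnorm mu <= 1]].

(* M(S)^** as functionals on M(S)^*: the values of [M] outside [Mdual] are
   irrelevant. *)
Definition Mbidual : set ((cmeasure R S -> R[i]) -> R[i]) :=
  [set M | (forall (a : R[i]) f g, Mdual f -> Mdual g ->
              M (fun mu => a * f mu + g mu) = a * M f + M g) /\
    exists C : R, forall f, Mdual f -> normc (M f) <= C * Mdual_norm f].

Definition nonneg_functional f := forall mu, positive_measure mu -> 0 <= f mu.

Definition one_functional : cmeasure R S -> R[i] := fun mu => mu setT.

Definition functional_act (mul : S -> S -> S) f mu : cmeasure R S -> R[i] :=
  fun lambda => f (measure_conv mul mu lambda).

Definition is_mean (M : (cmeasure R S -> R[i]) -> R[i]) :=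
  [/\ Mbidual M,
      forall f, Mdual f -> nonneg_functional f -> 0 <= M f &
      M one_functional = 1].

Definition topologically_left_invariant (mul : S -> S -> S)
    (M : (cmeasure R S -> R[i]) -> R[i]) :=
  forall mu f, M0 mu -> Mdual f -> M (functional_act mul f mu) = M f.

End duality.

Definition separately_continuous (S : topologicalType) (mul : S -> S -> S) :=
  (forall x, continuous (fun y => mul x y)) /\
  (forall y, continuous (fun x => mul x y)).

Definition semifoundation (R : realType) (S : ptopologicalType)
    (hS : hausdorff_space S) (mul : S -> S -> S) :=
  exists2 nu : cmeasure R S, M0 nu &
    forall (x : S) (eps : R), 0 < eps -> \forall y \near x,
      tvnorm (measure_conv mul (point_mass R hS y) nu - measure_conv mul (point_mass R hS x) nu)
        < eps.

(* Main.v *)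
(* A function g(xy) with g in C_0(S) is only separately continuous in (x, y). By an
   elementary form of Grothendieck's argument (two iterated limits along clusters),
   y |-> int g(xy) dmu(x) is nevertheless continuous, hence
   y |-> mu (U y^-1) is lower semicontinuous for U open and mu positive. The
   convolution of two positive measures is therefore the mixture
   int mu (A y^-1) dnu(y), which is regular; complex measures follow by linearity,
   and M(S) is determined by integrals of C_0 functions, so that * is bilinear.

   Both conditions are then equivalent to the existence, for finitely many th in
   M_0(S) and e > 0, of la in M_0(S) with ||th * la - la|| < e for all of them. An
   invariant mean gives such la by Hahn-Banach separation; they give (2) since every
   mu is a combination of elements of M_0(S), and (1) by taking limits of f(la) along
   an ultrafilter. Finally (2) applied to the measures th - delta_e, of total mass 0,
   gives them back, delta_e being a unit. *)
Require Import Defs.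
From HB Require Import structures.
From mathcomp Require Import all_boot all_order all_algebra finmap.
From mathcomp Require Import all_classical all_reals all_analysis.
From mathcomp Require Import measurable_realfun complex.
From mathcomp Require Import ring lra.

Set Implicit Arguments.
Unset Strict Implicit.
Unset Printing Implicit Defensive.

Import Order.TTheory GRing.Theory Num.Theory.
Import numFieldNormedType.Exports.

Local Open Scope classical_set_scope.
Local Open Scope ring_scope.

Local Notation Re := complex.Re.
Local Notation Im := complex.Im.

(** * Separately continuous functions on products of compact sets *)

(** [S] need not be second countable, and this shapes the measure theory. The function g(xy) may
    fail to be measurable for the product of the two Borel sigma-algebras, so Fubini's theorem is
    not at hand: the convolution is obtained as an integral of a kernel, whose measurability has to
    come from semicontinuity. Continuity at a point concerns neighbourhoods, whereas dominated
    convergence concerns sequences; Grothendieck's argument is what extracts a sequence. Regularity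
    is not automatic either: a compact set that nearly fills U y^-1 depends on y, while regularity
    asks for one compact C inside U that serves almost all y at once.

    An invariant mean is only a weak limit of elements of [M0], but almost invariance is a statement
    in norm. Convexity bridges the gap: if the tuples (th_i * la - la)_i stayed at distance e from 0
    as la runs through [M0], functionals f_i would separate them from 0, and the sum of the f_i th_i
    - f_i would dominate a positive multiple of 1, although an invariant mean vanishes on it. *)

Section locally_compact_hausdorff.
Context (R : realType) {S : ptopologicalType}.
Hypotheses (hS : hausdorff_space S) (lcS : locally_compact [set: S]).

Lemma lc_compact_nbhs (x : S) : exists2 W : set S, nbhs x W & compact W.
Proof. by have [//|W] := @lcS x; rewrite withinET => nW [cW _]; exists W. Qed.

(** The compact neighbourhood [W] is built into the closed set that complete regularity separates
    from [x], so that the bump vanishes off a compact set and not only off [U]. *)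
Lemma lc_point_urysohn (x : S) (U : set S) : open U -> U x ->
  exists (f : S -> R) (W : set S), [/\ compact W, continuous f,
    forall y, 0 <= f y <= 1, f x = 1 & forall y, ~ (U `&` W) y -> f y = 0].
Proof.
move=> oU Ux; have [W nW cW] := lc_compact_nbhs x.
have cr := @locally_compact_completely_regular S R lcS hS.
pose B := ~` (U `&` W°).
have cB : closed B by apply: open_closedC; apply: openI => //; exact: open_interior.
have nB : ~ B x by rewrite /B /= => -[]; split => //; exact: nW.
have /(@uniform_separatorP _ R)[f [cf f01 f0 f1]] := cr x B cB nB.
have {}f01 y : 0 <= f y <= 1.
  by have /f01 : range f (f y) by []; rewrite /= in_itv.
exists (fun y => 1 - f y), W; split => //.
- by move=> y; apply: continuousB; [exact: cvg_cst|exact: cf].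
- by move=> y; have /andP[a b] := f01 y; rewrite subr_ge0 b /= lerBlDr lerDl.
- by rewrite (f0 (f x)) ?subr0//; exists x.
- move=> y nUW; rewrite (f1 (f y)) ?subrr//; exists y => // -[Uy /interior_subset Wy].
  exact: nUW.
Qed.

Lemma lc_urysohn (K U : set S) : compact K -> open U -> K `<=` U ->
  exists (C : set S) (f : S -> R), [/\ compact C, C `<=` U, continuous f,
    forall y, 0 <= f y <= 1 & (forall y, K y -> f y = 1) /\
    (forall y, ~ C y -> f y = 0)].
Proof.
move=> cK oU KU.
have /choice[F FP] : forall x, exists p : (S -> R) * set S, U x ->
   [/\ compact p.2, continuous p.1, forall y, 0 <= p.1 y <= 1, p.1 x = 1 &
    forall y, ~ (U `&` p.2) y -> p.1 y = 0].
  move=> x.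
  have [Ux|nUx] := pselect (U x); last by exists (fun=> 0, set0).
  by have [f [W H]] := lc_point_urysohn oU Ux; exists (f, W).
have : cover_compact K by rewrite -compact_cover.
move=> /(_ _ U (fun x => (F x).1 @^-1` [set r | 1/2 < r]))[].
- move=> x Ux; have [_ cf _ _ _] := FP x Ux.
  by apply: open_comp => //; exact: open_gt.
- move=> x Kx; exists x; first exact: KU.
  by rewrite /=; have [_ _ _ -> _] := FP x (KU _ Kx); lra.
move=> D DU KD.
have DU' i : i \in D -> U i by move=> /DU /set_mem.
pose h y := \sum_(i <- D | i \in D) (F i).1 y.
have ch : continuous h.
  have -> : h = \sum_(i <- D | i \in D) (F i).1 by apply/funext => y; rewrite fct_sumE.
  elim/big_ind : _ => [y|f g cf cg y|i /DU'/FP[]//]; first exact: cvg_cst.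
  by apply: continuousD; [exact: cf|exact: cg].
have hle i y : i \in D -> (F i).1 y <= h y.
  move=> iD; rewrite /h -big_seq (big_fsetD1 i)//= lerDl big_seq sumr_ge0// => j.
  by rewrite !inE => /andP[_ /DU' /FP[_ _ /(_ y)/andP[]]].
(* On [K] one bump exceeds 1/2, hence 4h - 1 > 1 there; off [C], where h < 1/4, it is negative. [C]
   is closed and lies in the finite union of the compact sets attached to the bumps. *)
pose f y := Num.max 0 (Num.min 1 (4 * h y - 1)).
pose C := [set y | 1/4 <= h y].
have CD : C `<=` \big[setU/set0]_(i <- D | i \in D) (F i).2.
  move=> y Cy; apply: contrapT => nD.
  have h0 : h y = 0.
    apply: big1 => i iD; have [_ _ _ _ ->//] := FP i (DU' _ iD) => -[_ Wy]; apply: nD.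
    by rewrite -big_seq -bigcup_seq; exists i.
  by move: Cy; rewrite /C /= h0; lra.
exists C, f; split.
- apply: (subclosed_compact _ _ CD).
    by apply: (@closed_comp _ _ h [set r | 1 / 4 <= r]) => [y _|]; [exact: ch|exact: closed_ge].
  by apply: bigsetU_compact => i /DU' /FP[].
- move=> y Cy; apply: contrapT => nU.
  have h0 : h y = 0.
    by apply: big1 => i iD; have [_ _ _ _ ->//] := FP i (DU' _ iD) => -[].
  by move: Cy; rewrite /C /= h0; lra.
- move=> y; apply: (@continuous_max R S (cst 0) (fun y => Num.min 1 (4 * h y - 1))).
    exact: cvg_cst.
  apply: (@continuous_min R S (cst 1) (fun y => 4 * h y - 1)); first exact: cvg_cst.
  apply: continuousB; last exact: cvg_cst.
  by apply: continuousM; [exact: cvg_cst|exact: ch].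
- by move=> y; rewrite /f le_max lexx /= ge_max ler01 ge_min lexx.
- split=> y.
    move=> /KD[i /= iD hi]; have := hle i y iD => hh.
    by rewrite /f min_l ?max_r//; lra.
  move=> /negP; rewrite /C /= -ltNge => hy.
  by rewrite /f min_r ?max_l//; lra.
Qed.

End locally_compact_hausdorff.

(** Limits along ultrafilters stand in for convergent subsequences, which a compact space need not
    provide. *)
Lemma ultra_compact_cvg {I : Type} {T : topologicalType} (u : set_system I)
    (K : set T) (f : I -> T) : UltraFilter u -> compact K -> u (f @^-1` K) ->
  exists2 z, K z & f @ u --> z.
Proof.
rewrite compact_ultra => uu uK Kf.
have ufu : UltraFilter (f @ u).
  split; first exact: fmap_proper_filter.
  move=> G PG uG; apply/seteqP; split => [A GA|]; last exact: uG.
  have [//|uA] := in_ultra_setVsetC (f @^-1` A) uu.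
  have /(filterI GA)/filter_ex[x []//] : G (~` A) by exact: uG.
have [|z [Kz fz]] := uK (f @ u) ufu; last by exists z.
exact: Kf.
Qed.

Section grothendieck.
Context {R : realType} {X : ptopologicalType} {Y : topologicalType} (g : X -> Y -> R).
Hypotheses (gX : forall y, continuous (g ^~ y)) (gY : forall x, continuous (g x)).
Variables (K : set X) (L : set Y).
Hypotheses (cK : compact K) (cL : compact L).

(* [x'] runs through points that agree with [x] on longer and longer initial
   segments of [y_]: a cluster point of these and a cluster point of [y_] turn
   the two iterated limits of [g] into one value. *)
Lemma sepcont_cvg0 (y_ : nat -> Y) : (forall n, L (y_ n)) ->
  (forall m x, K x -> exists x', [/\ K x',
     forall i, (i <= m)%N -> `|g x (y_ i) - g x' (y_ i)| <= m.+1%:R^-1 &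
     g x' (y_ n) @[n --> \oo] --> (0 : R)]) ->
  forall x, K x -> g x (y_ n) @[n --> \oo] --> (0 : R).
Proof.
move=> yL net x Kx; apply/cvgrPdist_lt => eps e0; apply: contrapT => nn.
(* If convergence fails, [B] meets every cofinite set of indices, so some ultrafilter [u] finer than
   [\oo] contains [B]; along it the values stay at distance at least [eps] from 0. *)
pose B := [set n | ~ `|0 - g x (y_ n)| < eps].
have PB : ProperFilter (within B (\oo : set_system nat)).
  apply: Build_ProperFilter_ex => A AB; apply: contrapT => nA; apply: nn.
  move: AB; rewrite /within/=; apply: filterS => n An; apply: contrapT => nB.
  by apply: nA; exists n; exact: An.
have [u [uu Bu]] := ultraFilterLemma PB.
have uo A : (\oo : set_system nat) A -> u A.
  by move=> oA; apply: Bu; apply: filterS oA => n An _.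
have uB : u B by apply: Bu; rewrite /within/=; apply: filterE.
have [v [vu vo]] := ultraFilterLemma (eventually_filter : ProperFilter \oo).
have [z Lz yz] := ultra_compact_cvg uu cL (filterE _ yL).
have /choice[x_ xP] := fun m => net m x Kx.
have [|x0 Kx0 xx0] := @ultra_compact_cvg _ _ v K x_ vu cK.
  by apply: filterE => m; have [] := xP m.
have gz m : g (x_ m) z = 0.
  have [_ _ h] := xP m.
  apply: (@cvg_unique _ (@Rhausdorff R) ((fun n => g (x_ m) (y_ n)) @ u)) => //.
    by apply: (cvg_comp _ _ yz); exact: gY.
  by apply: cvg_trans h; move=> A /uo.
have gx0 : g x0 z = 0.
  apply: (@cvg_unique _ (@Rhausdorff R) ((fun m => g (x_ m) z) @ v)) => //.
    by apply: (cvg_comp _ (g ^~ z) xx0); exact: gX.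
  by have -> : (fun m => g (x_ m) z) = cst 0 by [apply/funext]; exact: cvg_cst.
have gxi i : g x0 (y_ i) = g x (y_ i).
  apply: (@cvg_unique _ (@Rhausdorff R) ((fun m => g (x_ m) (y_ i)) @ v)) => //.
    by apply: (cvg_comp _ (g ^~ (y_ i)) xx0); exact: gX.
  suff : (fun m => g (x_ m) (y_ i)) @ \oo --> g x (y_ i).
    by apply: cvg_trans => A /vo.
  apply/cvgrPdist_le => d d0.
  near=> m; have [_ /(_ i) h _] := xP m.
  apply: (le_trans (h _)).
    by near: m; exact: nbhs_infty_ge.
  near: m.
  by apply: filterS (near_infty_natSinv_lt (PosNum d0)) => k /ltW.
(* [x0] has the same values as [x] at every [y_ n], and g x0 is continuous at [z] with g x0 z = 0;
   this contradicts the choice of [B]. *)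
have : (fun n => g x (y_ n)) @ u --> (0 : R).
  have -> : (fun n => g x (y_ n)) = (fun n => g x0 (y_ n)) by apply/funext.
  by rewrite -gx0; apply: (cvg_comp _ _ yz); exact: gY.
move=> /cvgrPdist_lt /(_ _ e0) uA.
have [n [An Bn]] := filter_ex (filterI uA uB).
exact: Bn.
Unshelve. all: by end_near. Qed.

(** For finitely many y, the vector of the values g x y depends continuously on x, so the image of
    the compact set [K] is totally bounded. *)
Lemma sepcont_net (s : seq Y) (e : R) : 0 < e ->
  exists l : seq X, (forall x, x \in l -> K x) /\
   forall x, K x -> exists2 x', x' \in l &
     forall y, y \in s -> `|g x y - g x' y| <= e.
Proof.
move=> e0; have : cover_compact K by rewrite -compact_cover.
pose V x := [set x' | forall y, y \in s -> `|g x y - g x' y| < e].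
move=> /(_ _ K V)[x Kx|x Kx|D DK KD].
- rewrite openE /V {V} => x'; rewrite /interior /=.
  elim: s => [|y s IH] Vx'; first exact: filterE.
  have h : \forall x'' \near x', `|g x y - g x'' y| < e.
    have := Vx' y; rewrite mem_head => /(_ isT) h0.
    have : (fun x'' => `|g x y - g x'' y|) @ x' --> `|g x y - g x' y|.
      by apply: cvg_norm; apply: cvgB; [exact: cvg_cst|exact: gX].
    by move=> /cvgr_lt; apply.
  have {}IH := IH (fun z zs => Vx' z (@mem_behead _ (y :: s) z zs)).
  near=> x'' => z; rewrite inE => /orP[/eqP ->|zs]; first by near: x''.
  by move: z zs; near: x''.
- by exists x => // y _; rewrite subrr normr0.
exists (enum_fset D); split => [x /DK/set_mem//|x /KD[x' /= x'D Vx]].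
by exists x' => // y ys; rewrite distrC ltW// Vx.
Unshelve. all: by end_near. Qed.

(** This is where neighbourhoods of [y0] give way to a sequence. Each new term makes g small on the
    finite nets attached to all the earlier terms; a net point thus has limit 0 along the sequence,
    and [sepcont_cvg0] extends this to the whole of [K]. *)
Lemma sepcont_sequence (y0 : Y) (P : set Y) :
  (forall x, g x y0 = 0) ->
  (forall N, nbhs y0 N -> exists2 y, N y & P y) -> nbhs y0 L ->
  exists y_ : nat -> Y, (forall n, P (y_ n)) /\
    forall x, K x -> g x (y_ n) @[n --> \oo] --> (0 : R).
Proof.
move=> gy0 nP nL.
have /choice[net netP] : forall s, exists l : seq X, (forall x, x \in l -> K x) /\
   forall x, K x -> exists2 x', x' \in l &
     forall y, y \in s -> `|g x y - g x' y| <= (size s).+1%:R^-1.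
  by move=> s; apply: sepcont_net.
have /choice[pick pickP] : forall p : seq X * nat, exists y, [/\ P y, L y &
    forall x, x \in p.1 -> `|g x y| < p.2.+1%:R^-1].
  move=> [l n] /=.
  have : \forall y \near y0, forall x, x \in l -> `|g x y| < n.+1%:R^-1.
    elim: l => [|x l IH]; first exact: filterE.
    have h : \forall y \near y0, `|g x y| < n.+1%:R^-1.
      have : (fun y => `|g x y|) @ y0 --> `|g x y0|.
        by apply: cvg_norm; exact: gY.
      by move=> /cvgr_lt; apply; rewrite gy0 normr0.
    near=> y => z; rewrite inE => /orP[/eqP ->|zs]; first by near: y.
    by move: z zs; near: y.
  by move=> /(filterI nL)/nP[y [Ly gl] Py]; exists y.
(* The state holds the terms chosen so far, latest first, and the points of all nets built so far.
   The next term is picked with tolerance 1/(n+1) on these points, n being the number of earlier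
   terms. *)
pose step (p : seq Y * seq X) :=
  let s := pick (p.2, size p.1) :: p.1 in (s, p.2 ++ net s).
pose st n := iter n step ([::], [::]).
pose y_ n := pick ((st n).2, size (st n).1).
have sz n : size (st n).1 = n by elim: n => //= n ->.
have ys i m : (i < m)%N -> y_ i \in (st m).1.
  elim: m => // m IH; rewrite ltnS leq_eqVlt => /predU1P[->|/IH im].
    exact: mem_head.
  by rewrite inE im orbT.
have lmono m n x : (m <= n)%N -> x \in (st m).2 -> x \in (st n).2.
  move=> /subnK <-; elim: (n - m)%N => // k IH xm.
  by rewrite addSn /= mem_cat IH.
have yL n : L (y_ n) by have [] := pickP ((st n).2, size (st n).1).
exists y_; split=> [n|]; first by have [] := pickP ((st n).2, size (st n).1).
apply: (@sepcont_cvg0 y_ yL) => m x Kx.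
(* The state m+1 contains the terms of index 0 to m; its net has tolerance 1/(m+2), and its points
   remain in every later state. *)
have [nK /(_ _ Kx)[x' x'n gx']] := netP (st m.+1).1.
exists x'; split; first exact: nK.
- move=> i im; apply: le_trans (gx' _ _) _; first exact: ys.
  by rewrite sz lef_pV2 ?posrE// ler_nat.
- apply/cvgrPdist_lt => d d0; near=> n.
  rewrite sub0r normrN.
  have [_ _ /(_ x')] := pickP ((st n).2, size (st n).1).
  rewrite -/(y_ n) /= sz => h; apply: (lt_trans (h _)).
    apply: (@lmono m.+1); first by near: n; exact: nbhs_infty_ge.
    by rewrite /= mem_cat x'n orbT.
  by near: n; exact: (near_infty_natSinv_lt (PosNum d0)).
Unshelve. all: by end_near. Qed.

End grothendieck.

(** * Integrals of separately continuous functions *)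

Section bounded_measurable.
Context d {T : measurableType d} {R : realType}.
Implicit Types (f g : T -> R) (m : {finite_measure set T -> \bar R}).

(** A class of functions that are integrable for every finite measure at once, so that integrability
    need not be followed through changes of the measure. *)
Definition bounded_measurable f :=
  measurable_fun setT f /\ exists M : R, forall x, `|f x| <= M.

Lemma bounded_measurable_integrable m f :
  bounded_measurable f -> m.-integrable setT (EFin \o f).
Proof.
move=> [mf [M fM]]; apply: measurable_bounded_integrable => //.
  by rewrite ltey_eq fin_num_measure.
exists M; split; first exact: num_real.
by move=> x Mx y _; apply: le_trans (fM y) (ltW Mx).
Qed.

Lemma bounded_measurable_cst (c : R) : bounded_measurable (cst c).
Proof. by split; [exact: measurable_cst|exists `|c|]. Qed.

Lemma bounded_measurableD f g : bounded_measurable f -> bounded_measurable g ->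
  bounded_measurable (fun x => f x + g x).
Proof.
move=> [mf [M fM]] [mg [N gN]]; split; first exact: measurable_funD.
by exists (M + N) => x; apply: le_trans (ler_normD _ _) _; exact: lerD.
Qed.

Lemma bounded_measurableZ (c : R) f : bounded_measurable f ->
  bounded_measurable (fun x => c * f x).
Proof.
move=> [mf [M fM]]; split; first exact: measurable_funM.
by exists (`|c| * M) => x; rewrite normrM ler_wpM2l.
Qed.

Lemma bounded_measurableB f g : bounded_measurable f -> bounded_measurable g ->
  bounded_measurable (fun x => f x - g x).
Proof.
move=> bf bg; under eq_fun do rewrite -mulN1r.
by apply: bounded_measurableD => //; exact: bounded_measurableZ.
Qed.

Lemma bounded_measurable_norm f : bounded_measurable f ->
  bounded_measurable (fun x => `|f x|).
Proof.
move=> [mf [M fM]]; split; first exact: measurableT_comp.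
by exists M => x; rewrite normr_id.
Qed.

Lemma integral_fineK m f : bounded_measurable f ->
  (\int[m]_x f x)%:E = (\int[m]_x (f x)%:E)%E.
Proof.
move=> bf; rewrite /Rintegral fineK//.
exact: integrable_fin_num (bounded_measurable_integrable _ bf).
Qed.

End bounded_measurable.

Section borel.
Context {R : realType} {S : ptopologicalType}.

Lemma open_borel (A : set S) : open A -> measurable (A : set (borel S)).
Proof. exact: sub_sigma_algebra. Qed.

Lemma closed_borel (A : set S) : closed A -> measurable (A : set (borel S)).
Proof.
move=> cA; rewrite -[A]setCK; apply: measurableC.
by apply: open_borel; exact: closed_openC.
Qed.

Lemma compact_borel (A : set S) : hausdorff_space S -> compact A ->
  measurable (A : set (borel S)).
Proof. by move=> hS cA; apply: closed_borel; exact: compact_closed. Qed.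

Lemma continuous_borel_measurable (f : S -> R) : continuous f ->
  measurable_fun (setT : set (borel S)) (f : borel S -> R).
Proof.
move=> /continuousP cf; apply: (measurability _ (RGenOpens.measurableE R)).
move=> _ [_ [a [b ->]] <-]; rewrite setTI; apply: open_borel.
by apply: cf; exact: interval_open.
Qed.

Lemma continuous_borel_endo (f : S -> S) : continuous f ->
  measurable_fun (setT : set (borel S)) (f : borel S -> borel S).
Proof.
move=> /continuousP cf; apply: (@measurability _ _ (borel S) (borel S) _ _ (@open S)) => //.
move=> A [U oU <-]; rewrite setTI; apply: open_borel; exact: cf.
Qed.

Lemma continuous_bounded_measurable (f : S -> R) : continuous f ->
  (exists M, forall x, `|f x| <= M) -> bounded_measurable (f : borel S -> R).
Proof. by move=> cf bf; split => //; exact: continuous_borel_measurable. Qed.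

(** If continuity failed at [y0], the bad points [P] would meet every neighbourhood of [y0], and
    [sepcont_sequence] would give a sequence of bad points along which g x y - g x y0 tends to 0 for
    each x in [K]. Dominated convergence on [K] and tightness off [K] then contradict badness. *)
Lemma sepcont_integral_continuous {Y : topologicalType} (hS : hausdorff_space S)
    (m : {finite_measure set (borel S) -> \bar R}) (g : S -> Y -> R) (M : R) :
  (forall e : R, 0 < e -> exists2 K : set S, compact K & (m (~` K) < e%:E)%E) ->
  (forall y : Y, exists2 L, nbhs y L & compact L) ->
  (forall y, continuous (g ^~ y)) -> (forall x, continuous (g x)) ->
  (forall x y, `|g x y| <= M) ->
  continuous (fun y => \int[m]_x g x y).
Proof.
move=> tm lcY gX gY gM y0.
apply/cvgrPdist_lt => e e0; apply: contrapT => nn.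
have bg y : bounded_measurable (g^~ y : borel S -> R).
  by apply: continuous_bounded_measurable => //; exists M.
have [L nL cL] := lcY y0.
have M0 : 0 <= M by apply: le_trans (gM point y0).
(* Off [K] the difference is at most 2M, so this mass contributes at most e/2; the summand 1 keeps
   the denominator positive when M = 0. *)
have e2 : 0 < e / 2 / (2 * M + 1) by rewrite divr_gt0 ?divr_gt0//; lra.
have [K cK mK] := tm _ e2.
have mbK := compact_borel hS cK.
pose P y := ~ `|\int[m]_x g x y0 - \int[m]_x g x y| < e.
pose h x y := g x y - g x y0.
have [|||||y_ [yP hy]] := @sepcont_sequence R S Y h _ _ K L cK cL y0 P.
- by move=> y x; apply: continuousB; exact: gX.
- by move=> x y; apply: continuousB; [exact: gY|exact: cvg_cst].
- by move=> x; rewrite /h subrr.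
- move=> N nN; apply: contrapT => nP; apply: nn.
  by apply: filterS nN => y Ny; apply: contrapT => Py; apply: nP; exists y.
- by [].
have bh y : bounded_measurable (h ^~ y : borel S -> R) by exact: bounded_measurableB.
have h2M x y : `|h x y| <= 2 * M.
  by apply: le_trans (ler_normB _ _) _; rewrite mulr_natl mulr2n lerD.
have [|||||_ + _] := @dominated_convergence _ _ _ m K mbK
    (fun n x => (h x (y_ n))%:E) (cst 0)%E (cst (2 * M)%:E).
- move=> n; apply/measurable_EFinP; apply: measurable_funS (proj1 (bh (y_ n))) => //.
- exact: measurable_cst.
- by apply: aeW => x Kx; apply/fine_cvgP; split; [exact: nearW|exact: hy].
- exact: finite_measure_integrable_cst.
- by apply: aeW => x n _; rewrite lee_fin.
move=> /fine_cvgP[fin] /cvgrPdist_lt /(_ (e / 2)) []; first lra.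
move=> N1 _ N1P; case: fin => N2 _ N2P.
pose n := maxn N1 N2.
have {}N2P := N2P n (leq_maxr _ _).
have {}N1P := N1P n (leq_maxl _ _).
apply: (yP n); rewrite distrC -RintegralB//;
  [|exact: bounded_measurable_integrable..].
have mK' : measurable (~` K : set (borel S)) by exact: measurableC.
have ih := bounded_measurable_integrable m (bounded_measurable_norm (bh (y_ n))).
apply: le_lt_trans (le_normr_Rintegral _ _) _ => //.
  exact: (bounded_measurable_integrable m (bh (y_ n))).
rewrite -(setUv K) Rintegral_setU//; last 2 first.
- by rewrite setUv.
- by rewrite disj_set2E setICr.
have h1 : \int[m]_(x in K) `|h x (y_ n)| < e / 2.
  move: N1P; rewrite sub0r normrN; apply: le_lt_trans.
  apply: le_trans (ler_norm _); rewrite /= /Rintegral.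
  rewrite (eq_integral (fun x : borel S => `|(h x (y_ n))%:E - cst 0 x|)%E)// => x _.
  by rewrite /= subr0.
have h2 : \int[m]_(x in ~` K) `|h x (y_ n)| <= 2 * M * fine (m (~` K)).
  rewrite -Rintegral_cst//; apply: le_Rintegral => //.
    exact: integrableS ih.
  exact: finite_measure_integrable_cst.
have h3 : fine (m (~` K)) < e / 2 / (2 * M + 1).
  by rewrite -lte_fin fineK// fin_num_measure.
have h4 : 2 * M * fine (m (~` K)) <= e / 2.
  apply: (@le_trans _ _ (2 * M * (e / 2 / (2 * M + 1)))).
    by apply: ler_wpM2l; [lra|exact: ltW].
  rewrite mulrA ler_pdivrMr; last by lra.
  by nra.
by rewrite [e in _ < e]splitr; apply: ltr_leD => //; exact: le_trans h2 h4.
Qed.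

End borel.

(** * Convolution of positive regular measures *)

Section finite_measure_of.
Context d (T : measurableType d) (R : realType).
Variables (m : {measure set T -> \bar R}) (fm : fin_num_fun m).
(** The proof of finiteness is an argument of the function so that the instances declared on it can
    recover that proof. *)
Definition finite_measure_fun of fin_num_fun m : set T -> \bar R := m.
HB.instance Definition _ := Measure.on (finite_measure_fun fm).
HB.instance Definition _ := Measure_isFinite.Build _ T R (finite_measure_fun fm) fm.
Definition finite_measure_of : {finite_measure set T -> \bar R} :=
  finite_measure_fun fm.
End finite_measure_of.

Section mixture.
Context d {T : measurableType d} {R : realType}.
Variables (n : {finite_measure set T -> \bar R}) (k : T -> {finite_measure set T -> \bar R}).
Hypothesis mk : forall U, measurable U -> measurable_fun setT (k ^~ U).
Variable C : R.
Hypothesis kC : forall y, (k y setT < C%:E)%E.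

(** The measure [n] is read as a kernel from a one-point space, and [k] as a kernel on [unit * T]
    that ignores the first component: the mixture is then a composition of kernels. *)
Let l (_ : unit) : {measure set T -> \bar R} := n.
Let ml U : measurable U -> measurable_fun setT (l ^~ U).
Proof. by move=> _; exact: measurable_cst. Qed.
HB.instance Definition _ := isKernel.Build _ _ unit T R l ml.
Let l_uub : measure_fam_uub l.
Proof.
exists (fine (n setT) + 1) => x; rewrite /l EFinD fineK ?fin_num_measure//.
by rewrite lteDl ?fin_num_measure// lte_fin.
Qed.
HB.instance Definition _ := Kernel_isFinite.Build _ _ unit T R l l_uub.

Let k' (y : unit * T) : {measure set T -> \bar R} := k y.2.
Let mk' U : measurable U -> measurable_fun setT (k' ^~ U).
Proof.
move=> mU; apply: (@measurableT_comp _ _ _ _ _ _ (k ^~ U)); first exact: mk.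
exact: measurable_snd.
Qed.
HB.instance Definition _ := isKernel.Build _ _ (unit * T)%type T R k' mk'.
Let k'_uub : measure_fam_uub k'.
Proof. by exists C => x; exact: kC. Qed.
HB.instance Definition _ := Kernel_isFinite.Build _ _ (unit * T)%type T R k' k'_uub.

Lemma bounded_measurable_kernel_integral f : bounded_measurable f ->
  bounded_measurable (fun y => \int[k y]_x f x).
Proof.
move=> [mf [M fM]].
have C0 : 0 <= C.
  by rewrite -lee_fin; exact: le_trans (measure_ge0 (k point) setT) (ltW (kC point)).
have bf : bounded_measurable f by split => //; exists M.
have kC' y : fine (k y setT) <= C.
  by rewrite -lee_fin fineK ?fin_num_measure// ltW.
have M0 : 0 <= M by apply: le_trans (fM point).
split; last first.
  exists (M * C) => y.
  have ib := bounded_measurable_integrable (k y) (bounded_measurable_norm bf).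
  apply: le_trans (le_normr_Rintegral _ _) _ => //.
    exact: (bounded_measurable_integrable (k y) bf).
  apply: (@le_trans _ _ (\int[k y]_x M)).
    apply: le_Rintegral => //; exact: finite_measure_integrable_cst.
  by rewrite Rintegral_cst //; apply: ler_wpM2l M0 _ _ (kC' y).
(* Integrals against a kernel are known to be measurable for nonnegative functions, whence the shift
   by the bound [M]. The same shift serves in [finite_measure_mixture]. *)
have bMf : bounded_measurable (fun x => f x + M).
  by apply: bounded_measurableD => //; exact: bounded_measurable_cst.
have E y : \int[k y]_x f x = \int[k y]_x (f x + M) - M * fine (k y setT).
  rewrite RintegralD//; last 2 first.
  - exact: (bounded_measurable_integrable (k y) bf).
  - exact: finite_measure_integrable_cst.
  by rewrite Rintegral_cst// addrK.
under eq_fun do rewrite E.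
apply: measurable_funB; last first.
  apply: (@measurable_funM _ _ _ _ (cst M) (fun y => fine (k y setT))) => //.
  by apply: (@measurableT_comp _ _ _ _ _ _ fine _ (k ^~ setT)) => //; exact: mk.
apply: measurableT_comp => //.
apply: (@measurable_fun_integral_kernel _ _ _ _ R k mk (fun x => (f x + M)%:E)).
  by move=> x; rewrite lee_fin -lerBlDr sub0r; have := fM x; rewrite ler_norml => /andP[].
by apply/measurable_EFinP; case: bMf.
Qed.

Lemma finite_measure_mixture : exists p : {finite_measure set T -> \bar R},
  (forall A, p A = \int[n]_y k y A)%E /\
  forall f : T -> R, bounded_measurable f ->
    \int[p]_x f x = \int[n]_y \int[k y]_x f x.
Proof.
pose p : {measure set T -> \bar R} := mkcomp (l : R.-fker unit ~> T) (k' : R.-fker _ ~> T) tt.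
have pE A : (p A = \int[n]_y k y A)%E by [].
have fp : fin_num_fun p.
  apply: lty_fin_num_fun; rewrite pE.
  apply: (@le_lt_trans _ _ (\int[n]_y (C%:E))%E).
    apply: ge0_le_integral => //.
    - exact: mk.
    - by move=> y _; exact/ltW/kC.
  by rewrite integral_cst// -[_ (n setT)]fineK ?ltry// fin_numM// fin_num_measure.
pose q : {finite_measure set T -> \bar R} := finite_measure_of fp.
exists q; split => // f [mf [M fM]].
have intp (g : T -> \bar R) : (forall x, 0 <= g x)%E -> measurable_fun setT g ->
    (\int[q]_x g x = \int[n]_y \int[k y]_x g x)%E.
  exact: (integral_kcomp (l : R.-fker unit ~> T) (k' : R.-fker _ ~> T) tt).
have bf : bounded_measurable f by split => //; exists M.
have bM : bounded_measurable (cst M : T -> R) by exact: bounded_measurable_cst.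
have bMf : bounded_measurable (fun x => f x + M) by exact: bounded_measurableD.
have intq (g : T -> R) : (forall x, 0 <= g x) -> bounded_measurable g ->
    \int[q]_x g x = \int[n]_y \int[k y]_x g x.
  move=> g0 bg; rewrite {1}/Rintegral intp; first last.
  - by apply/measurable_EFinP; case: bg.
  - by move=> x; rewrite lee_fin.
  by congr fine; apply: eq_integral => y _; rewrite -integral_fineK.
have D (m : {finite_measure set T -> \bar R}) :
    \int[m]_x f x = \int[m]_x (f x + M) - \int[m]_x M.
  rewrite RintegralD//; [|exact: bounded_measurable_integrable..].
  by rewrite addrK.
have M0 : 0 <= M by apply: le_trans (fM point).
rewrite D intq//; last first.
  by move=> x; rewrite -lerBlDr sub0r; have := fM x; rewrite ler_norml => /andP[].
rewrite (intq (cst M))//.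
under [RHS]eq_Rintegral do rewrite D.
by rewrite RintegralB//; apply: bounded_measurable_integrable;
  exact: bounded_measurable_kernel_integral.
Qed.
End mixture.

Section fine_measure.
Context d {T : measurableType d} {R : realType}.
Variable m : {finite_measure set T -> \bar R}.

Lemma fine_measureD (A B : set T) : measurable A -> measurable B -> B `<=` A ->
  fine (m (A `\` B)) = fine (m A) - fine (m B).
Proof.
move=> mA mB BA; rewrite measureD//; last by rewrite ltey_eq fin_num_measure.
by rewrite setIC (setIidl BA) fineB// fin_num_measure.
Qed.

Lemma lt_fine_measure (A : set T) (e : R) : measurable A ->
  (m A < e%:E)%E = (fine (m A) < e).
Proof. by move=> mA; rewrite -lte_fin fineK// fin_num_measure. Qed.

Lemma gt_fine_measure (A : set T) (e : R) : measurable A ->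
  (e%:E < m A)%E = (e < fine (m A)).
Proof. by move=> mA; rewrite -lte_fin fineK// fin_num_measure. Qed.

Lemma fine_le_measure (A B : set T) : measurable A -> measurable B -> A `<=` B ->
  fine (m A) <= fine (m B).
Proof.
by move=> mA mB AB; apply: fine_le; rewrite ?fin_num_measure//; apply: le_measure;
  rewrite ?inE.
Qed.

End fine_measure.

Section indicator_bounds.
Context d {T : measurableType d} {R : realType}.
Variables (m : {finite_measure set T -> \bar R}) (f : T -> R) (A : set T).
Hypotheses (bf : bounded_measurable f) (mA : measurable A).

Lemma integral_le_measure : (forall x, f x <= \1_A x) -> ((\int[m]_x f x)%:E <= m A)%E.
Proof.
move=> fA; rewrite -[m A]fineK ?fin_num_measure// lee_fin.
have -> : fine (m A) = \int[m]_x \1_A x by rewrite /Rintegral integral_indic// setIT.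
apply: le_Rintegral => //; first exact: bounded_measurable_integrable.
exact: integrable_indic.
Qed.

Lemma measure_le_integral : (forall x, \1_A x <= f x) -> (m A <= (\int[m]_x f x)%:E)%E.
Proof.
move=> fA; rewrite -[m A]fineK ?fin_num_measure// lee_fin.
have -> : fine (m A) = \int[m]_x \1_A x by rewrite /Rintegral integral_indic// setIT.
apply: le_Rintegral => //; last exact: bounded_measurable_integrable.
exact: integrable_indic.
Qed.

End indicator_bounds.

Definition regular_measure {R : realType} {S : ptopologicalType}
    (m : set (borel S) -> \bar R) :=
  forall (A : set S) (e : R), is_borel A -> 0 < e ->
  exists K U, [/\ compact K, open U, K `<=` A, A `<=` U & (m (U `\` K) < e%:E)%E].

Section regular.
Context {R : realType} {S : ptopologicalType}.
Hypotheses (hS : hausdorff_space S).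
Implicit Types m : {finite_measure set (borel S) -> \bar R}.

Lemma regular_tight m : regular_measure m ->
  forall e : R, 0 < e -> exists2 K : set S, compact K & (m (~` K) < e%:E)%E.
Proof.
move=> rm e e0; have [|K [U [cK oU KT TU mUK]]] := rm setT e _ e0; first exact: measurableT.
by exists K => //; rewrite (_ : ~` K = U `\` K)//; apply/seteqP; split => x;
  [move=> nK; split => //; exact: TU|case].
Qed.

Lemma regular_inner m (A : set S) (t : R) : regular_measure m -> is_borel A ->
  (t%:E < m A)%E -> exists2 K, compact K /\ K `<=` A & (t%:E < m K)%E.
Proof.
move=> rm bA; rewrite gt_fine_measure// => tA; pose e := fine (m A) - t.
have e0 : 0 < e by rewrite subr_gt0.
have [K [U [cK /open_borel bU KA AU H]]] := rm A e bA e0; exists K => //.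
have bK := compact_borel hS cK.
move: H; rewrite gt_fine_measure// lt_fine_measure//; last exact: measurableD.
rewrite fine_measureD//; last exact: subset_trans AU.
by have := fine_le_measure m bA bU AU; rewrite /e; lra.
Qed.

Lemma regular_outer m (A : set S) (t : R) : regular_measure m -> is_borel A ->
  (m A < t%:E)%E -> exists2 U, open U /\ A `<=` U & (m U < t%:E)%E.
Proof.
move=> rm bA; rewrite lt_fine_measure// => tA; pose e := t - fine (m A).
have e0 : 0 < e by rewrite subr_gt0.
have [K [U [cK oU KA AU H]]] := rm A e bA e0; exists U => //.
have bU := open_borel oU; have bK := compact_borel hS cK.
move: H; rewrite !lt_fine_measure//; last exact: measurableD.
rewrite fine_measureD//; last exact: subset_trans AU.
by have := fine_le_measure m bK bA KA; rewrite /e; lra.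
Qed.

(* The sets that are approximated from inside by closed sets and from outside by
   open sets form a sigma-algebra, so that only open sets need to be tested. *)
Lemma regular_of_open m :
  (forall (U : set S) (e : R), open U -> 0 < e ->
    exists K, [/\ compact K, K `<=` U & (m (U `\` K) < e%:E)%E]) ->
  regular_measure m.
Proof.
move=> inner.
pose P (A : set S) := forall e : R, 0 < e -> exists F U, [/\ closed F, open U, F `<=` A,
  A `<=` U & (m (U `\` F) < e%:E)%E].
have Pborel : forall A : set S, is_borel A -> P A.
  apply: (@smallest_sub _ (sigma_algebra setT) (@open S) P); last first.
    move=> U oU e e0; have [K [cK KU mUK]] := inner U e oU e0.
    by exists K, U; split => //; exact: compact_closed.
  split.
  - move=> e e0; exists set0, set0; split => //; [exact: closed0|exact: open0|].
    by rewrite setD0 measure0 lte_fin.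
  - move=> A PA e e0; have [F [U [cF oU FA AU mUF]]] := PA e e0.
    exists (~` U), (~` F); rewrite setTD; split.
    + exact: open_closedC.
    + exact: closed_openC.
    + exact: subsetC.
    + exact: subsetC.
    + by rewrite setDE setCK setIC -setDE.
  - move=> A PA e e0.
    (* These tolerances add up to e/2, which leaves a strict margin below e. *)
    have ek k : 0 < e / 2 / (2 ^ k.+1)%:R.
      by rewrite !divr_gt0// ltr0n expn_gt0.
    have /choice[FU FUP] : forall k, exists FU : set S * set S, [/\ closed FU.1, open FU.2,
        FU.1 `<=` A k, A k `<=` FU.2 & (m (FU.2 `\` FU.1) < (e / 2 / (2 ^ k.+1)%:R)%:E)%E].
      by move=> k; have [F [U H]] := PA k _ (ek k); exists (F, U).
    pose U := \bigcup_k (FU k).2; pose F := \bigcup_k (FU k).1.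
    pose F1 k := (FU k).1; pose G n := \big[setU/set0]_(k < n) F1 k.
    have bF1 k : measurable ((FU k).1 : set (borel S)).
      by apply: closed_borel; have [] := FUP k.
    have bF2 k : measurable ((FU k).2 : set (borel S)).
      by apply: open_borel; have [] := FUP k.
    have bU : measurable (U : set (borel S)) by exact: bigcupT_measurable.
    have bF : measurable (F : set (borel S)) by exact: bigcupT_measurable.
    have bG k : measurable (G k : set (borel S)) by apply: bigsetU_measurable => i _; exact: bF1.
    have mUF : (m (U `\` F) < e%:E)%E.
      apply: (@le_lt_trans _ _ (e / 2)%:E); last by rewrite lte_fin; lra.
      apply: le_trans (epsilon_trick0 xpredT _); last by lra.
      apply: (@le_trans _ _ (\sum_(0 <= k <oo) m ((FU k).2 `\` (FU k).1))%E).
        apply: measure_sigma_subadditive.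
        - by move=> k; exact: measurableD.
        - exact: measurableD.
        - by move=> x [[k _ Uk] nF]; exists k => //; split => // Fk; apply: nF; exists k.
      by apply: lee_nneseries => // k _; apply: ltW; have [] := FUP k.
    (* The countable union [F] of closed sets need not be closed. Continuity from above replaces it
       by a finite union [G k], at a cost that still fits below e. *)
    have : (m \o (fun k => U `\` G k)) @ \oo --> m (\bigcap_k (U `\` G k)).
      apply: nonincreasing_cvg_mu.
      - by rewrite ltey_eq fin_num_measure//; exact: measurableD.
      - by move=> k /=; exact: measurableD.
      - by apply: bigcapT_measurable => k; exact: measurableD.
      - move=> k1 k2 k12; apply/subsetPset; apply: setDS.
        rewrite /G -!bigcup_mkord => x [j jk Fj]; exists j => //=; exact: leq_trans jk k12.
    rewrite (_ : \bigcap_k _ = U `\` F); last first.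
      apply/seteqP; split => x.
        move=> UG; split; first by have [] := UG 0%N I.
        move=> [k _ Fk]; have [_] := UG k.+1 I; apply; rewrite /G -bigcup_mkord.
        by exists k => /=.
      move=> [Ux nF] k _; split => //; rewrite /G -bigcup_mkord => -[j _ Fj].
      by apply: nF; exists j.
    rewrite -[X in _ --> X]fineK; last by apply: fin_num_measure; exact: measurableD.
    move=> /fine_cvgP[_ /cvgr_lt]; rewrite lt_fine_measure in mUF; last exact: measurableD.
    move=> /(_ _ mUF)[k _ /(_ k (leqnn k)) /= Gk].
    exists (G k), U; split.
    + by apply: closed_bigsetU => j _; have [] := FUP j.
    + by apply: bigcup_open => j _; have [] := FUP j.
    + rewrite /G -bigcup_mkord => x [j _ Fj]; exists j => //.
      by have [_ _ + _ _] := FUP j; exact.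
    + by move=> x [j _ Aj]; exists j => //; have [_ _ _ + _] := FUP j; exact.
    + by rewrite lt_fine_measure//; exact: measurableD.
move=> A e bA e0; have e2 : 0 < e / 2 by lra.
have [F [U [cF oU FA AU mUF]]] := Pborel A bA _ e2.
(* The inner set [F] is only closed; intersecting it with a compact set of nearly full mass makes it
   compact. *)
have [K0 [cK0 _ mK0]] := inner setT _ openT e2.
have bK0 := compact_borel hS cK0.
have bU := open_borel oU; have bF := closed_borel cF.
exists (F `&` K0), U; split => //.
- by rewrite setIC; apply: compact_closedI.
- by move=> x [/FA].
apply: (@le_lt_trans _ _ (m (U `\` F) + m (setT `\` K0))%E).
  apply: le_trans (measureU2 _ _ _); try exact: measurableD.
  apply: le_measure; rewrite ?inE.
  - by apply: measurableD => //; exact: measurableI.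
  - by apply: measurableU; exact: measurableD.
  - move=> x [Ux nFK]; have [Fx|nFx] := pselect (F x); last by left.
    by right; split => // K0x; apply: nFK.
by rewrite [e]splitr EFinD; exact: lteD.
Qed.

End regular.

Lemma finite_measure_pushforward d d' (T : measurableType d) (T' : measurableType d')
    (R : realType) (m : {finite_measure set T -> \bar R}) (f : T -> T') :
  measurable_fun setT f -> exists k : {finite_measure set T' -> \bar R},
  (forall A, k A = m (f @^-1` A)) /\
  forall g : T' -> R, bounded_measurable g -> \int[k]_x g x = \int[m]_x g (f x).
Proof.
move=> mf; have fk : fin_num_fun (pushforward m f).
  move=> A mA; apply: fin_num_measure; rewrite -[X in measurable X]setTI; exact: mf.
unshelve refine (ex_intro _ (@finite_measure_of _ _ _ (pushforward m f) _) _) => //.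
split=> // g bg; rewrite /Rintegral; congr fine.
apply: (integral_pushforward mf (mu := m) (D := setT) (f := EFin \o g)) => //.
- by apply/measurable_EFinP; case: bg.
- rewrite preimage_setT; apply: bounded_measurable_integrable.
  case: bg => [mg [M gM]]; split; last by exists M.
  exact: measurableT_comp.
Qed.

Section positive_convolution.
Context {R : realType} {S : ptopologicalType} (mul : S -> S -> S).
Hypotheses (hS : hausdorff_space S) (lcS : locally_compact [set: S]).
Hypothesis sc : separately_continuous mul.
Variable m : {finite_measure set (borel S) -> \bar R}.
Hypothesis rm : regular_measure m.

Lemma continuous_mull y : continuous (mul^~ y). Proof. exact: (proj2 sc). Qed.
Lemma continuous_mulr x : continuous (mul x). Proof. exact: (proj1 sc). Qed.

Lemma continuous_translate_integral (f : S -> R) : continuous f ->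
  (exists M, forall x, `|f x| <= M) -> continuous (fun y => \int[m]_x f (mul x y)).
Proof.
move=> cf [M fM].
apply: (@sepcont_integral_continuous R S S hS m (fun x y => f (mul x y)) M).
- exact: regular_tight.
- by move=> y; have [W nW cW] := lc_compact_nbhs lcS y; exists W.
- move=> y x; apply: (@continuous_comp _ _ _ (mul^~ y) f); last exact: cf.
  exact: continuous_mull.
- move=> x y; apply: (@continuous_comp _ _ _ (mul x) f); last exact: cf.
  exact: continuous_mulr.
- by move=> x y; exact: fM.
Qed.

Lemma borel_translate y (A : set S) : is_borel A -> is_borel (mul^~ y @^-1` A).
Proof.
move=> bA; rewrite -[X in is_borel X]setTI.
by apply: (continuous_borel_endo (@continuous_mull y)).
Qed.

(** Choose a compact K inside U y0^-1 of mass above t and a bump f that is 1 on the compact set K y0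
    and vanishes off a compact C inside U. The integral of f(xy) is continuous in y, exceeds t at y0
    and is at most m (C y^-1). Lower semicontinuity would only need U; that one C works for all y
    near y0 is what regularity will use. *)
Lemma translate_lsc (U : set S) (y0 : S) (t : R) : open U ->
  (t%:E < m (mul^~ y0 @^-1` U))%E ->
  exists C, [/\ compact C, C `<=` U & \forall y \near y0, (t%:E < m (mul^~ y @^-1` C))%E].
Proof.
move=> oU tU.
have bU : is_borel (mul^~ y0 @^-1` U) by apply: borel_translate; exact: open_borel.
have [K [cK KU] tK] := regular_inner hS rm bU tU.
have bK : is_borel K by exact: compact_borel.
have cKy : compact (mul^~ y0 @` K).
  by apply: continuous_compact => //; apply: continuous_subspaceT; exact: continuous_mull.
have [|C [f [cC CU cf f01 [f1 f0]]]] := lc_urysohn R hS lcS cKy oU.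
  by move=> _ [x Kx <-]; exact: KU.
have fM : exists M, forall x, `|f x| <= M.
  by exists 1 => x; have /andP[a b] := f01 x; rewrite ger0_norm.
have bf y : bounded_measurable ((fun x => f (mul x y)) : borel S -> R).
  apply: continuous_bounded_measurable; last by have [M h] := fM; exists M.
  move=> x; apply: (@continuous_comp _ _ _ (mul^~ y) f); last exact: cf.
  exact: continuous_mull.
exists C; split => //.
have : (\int[m]_x f (mul x y)) @[y --> y0] --> \int[m]_x f (mul x y0).
  exact: continuous_translate_integral.
move=> /cvgr_gt /(_ t); have /[swap]/[apply] : t < \int[m]_x f (mul x y0).
  rewrite -lte_fin; apply: lt_le_trans tK _; apply: measure_le_integral => // x.
  rewrite indicE; case: (boolP (x \in K)) => [/set_mem Kx|_].
    by rewrite f1//; exists x.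
  by have /andP[] := f01 (mul x y0).
apply: filterS => y ty; apply: (@lt_le_trans _ _ (\int[m]_x f (mul x y))%:E) => //.
apply: integral_le_measure => //.
  by apply: borel_translate; exact: compact_borel.
move=> x; rewrite indicE; case: (boolP (x \in _)) => [_|].
  by have /andP[] := f01 (mul x y).
by move=> /negP nC; rewrite f0// => Cx; apply: nC; apply/mem_set.
Qed.

(** For open sets the superlevel sets are open by [translate_lsc]; the open sets form a pi-system,
    and a Dynkin argument reaches all Borel sets. *)
Lemma measurable_translate (A : set S) : is_borel A ->
  measurable_fun setT (fun y : borel S => m (mul^~ y @^-1` A)).
Proof.
have := @dynkin_induction _ (borel S) (@open S)
  (fun A => measurable_fun setT (fun y : borel S => m (mul^~ y @^-1` A))) erefl.
apply.
- by move=> U V; exact: openI.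
- by under eq_fun do rewrite preimage_setT; exact: measurable_cst.
- move=> U oU; apply: (measurability _ (ErealGenOInfty.measurableE R)).
  move=> /= _ [_ [a ->]] <-; rewrite setTI; apply: open_borel.
  rewrite preimage_itvoy; set V := (X in open X); rewrite (_ : open V = (V `<=` V°)) ?openE//.
  move=> y /= ay.
  have [C [cC CU nC]] := translate_lsc oU ay.
  apply: filterS nC => z /lt_le_trans; apply; apply: le_measure; rewrite ?inE.
  + by apply: borel_translate; exact: compact_borel.
  + by apply: borel_translate; exact: open_borel.
  + by move=> x; exact: CU.
- move=> B bB mB.
  rewrite (_ : (fun y => _) = (fun y => m setT - m (mul^~ y @^-1` B))%E); last first.
    apply/funext => y; rewrite preimage_setC -setTD measureD ?setTI//.
    - exact: measurableT.
    - exact: borel_translate bB.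
    - by rewrite ltey_eq; apply/orP; left; apply: fin_num_measure; exact: measurableT.
  exact: emeasurable_funB.
- move=> F mF tF PF.
  rewrite (_ : (fun y => _) = (fun y => \sum_(0 <= k <oo) m (mul^~ y @^-1` F k))%E); last first.
    apply/funext => y; rewrite preimage_bigcup; apply/esym/cvg_lim => //.
    apply: measure_sigma_additive.
    + by move=> k; exact: borel_translate (mF k).
    + apply/trivIsetP => i j _ _ ij; rewrite -preimage_setI.
      by move/trivIsetP : tF => /(_ _ _ I I ij) ->; rewrite preimage_set0.
  rewrite (_ : (fun y => _) = (fun y => \sum_(k <oo | k \in xpredT) m (mul^~ y @^-1` F k))%E)//.
  exact: ge0_emeasurable_sum.
Qed.

(** The sets [C] given by [translate_lsc] work on neighbourhoods; finitely many of these cover [K],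
    and the union of the corresponding [C] works on all of it. *)
Lemma compact_translate_lsc (U K : set S) (t : R) : open U -> compact K ->
  (forall y, K y -> (t%:E < m (mul^~ y @^-1` U))%E) ->
  exists C, [/\ compact C, C `<=` U & forall y, K y -> (t%:E < m (mul^~ y @^-1` C))%E].
Proof.
move=> oU cK Kt.
have /choice[C CP] : forall y, exists C, K y -> [/\ compact C, C `<=` U &
    \forall z \near y, (t%:E < m (mul^~ z @^-1` C))%E].
  move=> y; have [Ky|] := pselect (K y); last by exists set0.
  by have [C CP] := translate_lsc oU (Kt _ Ky); exists C.
have : cover_compact K by rewrite -compact_cover.
pose V y := [set z | t%:E < m (mul^~ z @^-1` C y)]%E°.
move=> /(_ _ K V)[y Ky|y Ky|D DK KD]; first exact: open_interior.
  by exists y => //; have [_ _] := CP y Ky.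
have cC : compact (\big[setU/set0]_(i <- D | i \in D) C i).
  by apply: bigsetU_compact => i /DK/set_mem/CP[].
have CU : \big[setU/set0]_(i <- D | i \in D) C i `<=` U.
  by rewrite -big_seq -bigcup_seq => x [i /= /DK/set_mem/CP[_ + _] Cx]; exact.
exists (\big[setU/set0]_(i <- D | i \in D) C i); split => // y /KD[i /= iD].
move=> /interior_subset /lt_le_trans; apply; apply: le_measure; rewrite ?inE.
- apply: borel_translate; apply: compact_borel => //.
  by have [] := CP i (set_mem (DK _ iD)).
- by apply: borel_translate; exact: compact_borel.
- by apply: preimage_subset => x Cx; rewrite -big_seq -bigcup_seq; exists i.
Qed.

Variable n : {finite_measure set (borel S) -> \bar R}.
Hypothesis rn : regular_measure n.

Lemma bounded_measurable_translate (A : set S) : is_borel A ->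
  bounded_measurable (fun y : borel S => fine (m (mul^~ y @^-1` A))).
Proof.
move=> bA; split; first by apply: measurableT_comp => //; exact: measurable_translate.
exists (fine (m setT)) => y; rewrite ger0_norm ?fine_ge0//.
by apply: fine_le_measure => //; exact: borel_translate.
Qed.

(* The levels of [y |-> m (U y^-1)] cut [S] into finitely many Borel sets, on a
   compact part of which the values are nearly attained on compact subsets of [U]. *)
Lemma translate_inner (U : set S) (e : R) : open U -> 0 < e ->
  exists C, [/\ compact C, C `<=` U &
    \int[n]_y fine (m (mul^~ y @^-1` (U `\` C))) < e].
Proof.
move=> oU e0; have bU := open_borel oU.
set M := fine (m setT); set N := fine (n setT).
have M0 : 0 <= M by rewrite fine_ge0.
have N0 : 0 <= N by rewrite fine_ge0.
pose h y := fine (m (mul^~ y @^-1` U)).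
have hM y : 0 <= h y <= M.
  by rewrite fine_ge0//= fine_le_measure//; exact: borel_translate.
(* The integrand will be at most 2c on a compact set [L] and at most M off it. The choice of c gives
   2cN <= e/2. Since M < kc, the k levels [A j] of height c exhaust [S]; their compact parts miss a
   mass of at most dk = e/4/(M+1), which costs at most e/4. The total stays below e. *)
pose c := e / 4 / (N + 1).
have c0 : 0 < c by rewrite !divr_gt0//; lra.
pose k := (Num.truncn (M / c)).+1.
have Mk : M < k%:R * c by rewrite -ltr_pdivrMr// truncnS_gt.
pose d := e / 4 / (M + 1) / k%:R.
have d0 : 0 < d by rewrite !divr_gt0//; lra.
pose A j : set S := [set y | j%:R * c <= h y < j.+1%:R * c].
have bA j : is_borel (A j).
  have [mh _] := bounded_measurable_translate bU.
  rewrite (_ : A j = [set: borel S] `&` (h @^-1` `[j%:R * c, j.+1%:R * c[)); last first.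
    by rewrite setTI; apply/seteqP; split => y /=; rewrite in_itv.
  exact: (mh measurableT _ (measurable_itv _)).
have /choice[K KP] : forall j, exists K, [/\ compact K, K `<=` A j &
    fine (n (A j `\` K)) < d].
  move=> j; have [K [V [cK /open_borel bV KA AV]]] := rn (bA j) d0.
  have bK := compact_borel hS cK.
  rewrite lt_fine_measure; last exact: measurableD bV bK.
  move=> VK; exists K; split => //; apply: le_lt_trans VK; apply: fine_le_measure.
  - exact: measurableD (bA j) bK.
  - exact: measurableD bV bK.
  - exact: setSD.
(* On [A j] the value jc may be attained, and [compact_translate_lsc] asks for a strict inequality:
   the threshold is lowered by one step, so the loss on [K j] is at most 2c. *)
have /choice[C CP] : forall j, exists C, [/\ compact C, C `<=` U &
    forall y, K j y -> ((j%:R * c - c)%:E < m (mul^~ y @^-1` C))%E].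
  move=> j; have [cK KA _] := KP j; apply: compact_translate_lsc => // y /KA[/andP[jh _]].
  rewrite gt_fine_measure; last exact: borel_translate.
  by apply: lt_le_trans jh; rewrite ltrBlDr ltrDl.
pose L := \big[setU/set0]_(j < k) K j.
pose CC := \big[setU/set0]_(j < k) C j.
have cC : compact CC by apply: bigsetU_compact => j _; have [] := CP j.
have bCC := compact_borel hS cC.
have bL : is_borel L.
  by apply: bigsetU_measurable => j _; apply: compact_borel => //; have [] := KP j.
have nL : fine (n (~` L)) <= d * k%:R.
  have bAK j : measurable (A j `\` K j : set (borel S)).
    by apply: measurableD (bA j) _; apply: compact_borel => //; have [] := KP j.
  apply: (@le_trans _ _ (\sum_(j < k) fine (n (A j `\` K j)))); last first.
    rewrite mulr_natr -[k in leRHS]card_ord -sumr_const.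
    by apply: ler_sum => j _; apply: ltW; have [] := KP j.
  rewrite -lee_fin fineK ?fin_num_measure//; last exact: measurableC.
  rewrite -sumEFin.
  under eq_bigr do rewrite fineK ?fin_num_measure//.
  apply: (@le_trans _ _ (n (\big[setU/set0]_(j < k) (A j `\` K j)))); last first.
    exact: (@le_mu_bigsetU _ _ _ n (fun j => A j `\` K j)).
  apply: le_measure; rewrite ?inE.
  - exact: measurableC.
  - exact: bigsetU_measurable.
  - move=> y nLy.
    pose j := Num.truncn (h y / c).
    have /andP[h0 hM'] := hM y.
    have /andP[j1 j2] : j%:R <= h y / c < j.+1%:R.
      by apply: truncn_itv; rewrite divr_ge0// ltW.
    have jk : (j < k)%N.
      by rewrite ltnS; apply: le_truncn; rewrite ler_pM2r ?invr_gt0.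
    rewrite -(@bigcup_mkord _ k (fun j => A j `\` K j)); exists j => //; split.
      by rewrite /A /= -ler_pdivlMr// j1/= -ltr_pdivrMr.
    by move=> Kj; apply: nLy; rewrite /L -bigcup_mkord; exists j.
have bD : is_borel (U `\` CC) by exact: measurableD bU bCC.
exists CC; split => //.
  by rewrite /CC -bigcup_mkord => x [j _ Cx]; have [_ + _] := CP j; exact.
have b1 : bounded_measurable (cst (2 * c) : borel S -> R).
  exact: bounded_measurable_cst.
have b2 : bounded_measurable (fun y : borel S => M * \1_(~` L) y).
  apply: bounded_measurableZ; split; first by apply: measurable_indic; exact: measurableC.
  by exists 1 => y; rewrite ger0_norm// indicE; case: (_ \in _).
apply: (@le_lt_trans _ _ (\int[n]_y (2 * c + M * \1_(~` L) y))).
  apply: le_Rintegral => //.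
  - by apply: bounded_measurable_integrable; exact: bounded_measurable_translate.
  - by apply: bounded_measurable_integrable; exact: bounded_measurableD.
  move=> y _; rewrite indicE; case: (boolP (y \in ~` L)) => [_|].
    rewrite mulr1; apply: (@le_trans _ _ M); last by lra.
    by apply: fine_le_measure => //; exact: borel_translate.
  move=> /negP nL'; rewrite mulr0 addr0.
  have : L y by apply: contrapT => nLy; apply: nL'; apply/mem_set.
  rewrite /L -bigcup_mkord => -[j /= jk Kj].
  have [_ /(_ _ Kj)/andP[_ hy] _] := KP j.
  have [cCj _ /(_ _ Kj)] := CP j.
  have bCj := compact_borel hS cCj.
  rewrite gt_fine_measure; last exact: borel_translate.
  have : fine (m (mul^~ y @^-1` C j)) <= fine (m (mul^~ y @^-1` CC)).
    apply: fine_le_measure; [exact: borel_translate..|].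
    by apply: preimage_subset => x Cx; rewrite /CC -bigcup_mkord; exists j.
  rewrite -[_ @^-1` (U `\` CC)]/(mul^~ y @^-1` U `\` mul^~ y @^-1` CC) fine_measureD.
  - by move: hy; rewrite /h -natr1 mulrDl mul1r; lra.
  - exact: borel_translate.
  - exact: borel_translate.
  - apply: preimage_subset; rewrite /CC -bigcup_mkord => x [i _ Cx].
    by have [_ + _] := CP i; exact.
rewrite RintegralD//; [|exact: bounded_measurable_integrable..].
rewrite Rintegral_cst// RintegralZl//; last first.
  exact: (@integrable_indic _ _ _ n _ (measurableC bL)).
rewrite /Rintegral integral_indic ?setIT//; last exact: measurableC.
rewrite -/N.
have h1 : 2 * c * N <= e / 2.
  have -> : 2 * c * N = e / 2 * (N / (N + 1)) by rewrite /c; field; lra.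
  by rewrite ler_piMr// ?ler_pdivrMr//; lra.
have h2 : M * fine (n (~` L)) <= e / 4.
  apply: (@le_trans _ _ (M * (d * k%:R))); first exact: ler_wpM2l.
  rewrite /d -mulrA mulVf ?mulr1 ?pnatr_eq0//.
  by rewrite mulrCA ler_piMr// ?ler_pdivrMr//; lra.
lra.
Qed.

(** The kernel at y is the image of [m] under right translation by y. Since p (U minus C) is the
    n-integral of m ((U minus C) y^-1), [translate_inner] is exactly the hypothesis of
    [regular_of_open] for [p]. *)
Lemma positive_convolution : exists p : {finite_measure set (borel S) -> \bar R},
  [/\ regular_measure p, fine (p setT) = fine (m setT) * fine (n setT) &
   forall f : S -> R, continuous f -> (exists M, forall x, `|f x| <= M) ->
    \int[p]_x f x = \int[n]_y \int[m]_x f (mul x y)].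
Proof.
have /choice[k kP] := fun y =>
  finite_measure_pushforward m (continuous_borel_endo (@continuous_mull y)).
have kE y A : k y A = m (mul^~ y @^-1` A) by have [h _] := kP y; exact: h.
have [||p [pE pint]] := @finite_measure_mixture _ (borel S) R n k _ (fine (m setT) + 1).
- move=> A bA; under eq_fun do rewrite kE; exact: measurable_translate.
- by move=> y; rewrite kE preimage_setT lt_fine_measure// ltrDl.
have fpE A : is_borel A -> fine (p A) = \int[n]_y fine (m (mul^~ y @^-1` A)).
  move=> bA; rewrite pE /Rintegral; congr fine; apply: eq_integral => y _.
  by rewrite kE fineK//; apply: fin_num_measure; exact: borel_translate.
exists p; split.
- apply: regular_of_open => // U e oU e0.
  have [C [cC CU UC]] := translate_inner oU e0; exists C; split => //.
  have bUC := measurableD (open_borel oU) (compact_borel hS cC).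
  by rewrite lt_fine_measure// fpE.
- rewrite fpE; last exact: measurableT.
  by rewrite -Rintegral_cst.
- move=> f cf bf; have bmf := continuous_bounded_measurable cf bf.
  by rewrite pint//; apply: eq_Rintegral => y _; have [_ ->] := kP y.
Qed.

End positive_convolution.

(** * Complex measures and their integrals *)

Section signed_integral.
Context d {T : measurableType d} {R : realType}.
Implicit Types (p q r : {finite_measure set T -> \bar R}) (f : T -> R).

Lemma bounded_measurable_shift f : bounded_measurable f ->
  exists2 M : R, 0 <= M & forall x, 0 <= f x + M.
Proof.
move=> [_ [M fM]]; exists M; first exact: le_trans (fM point).
by move=> x; have := fM x; rewrite ler_norml -lerBlDr sub0r => /andP[].
Qed.

Lemma Rintegral_measureD p q r f : bounded_measurable f ->
  (forall A, measurable A -> r A = (p A + q A)%E) ->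
  \int[r]_x f x = \int[p]_x f x + \int[q]_x f x.
Proof.
move=> bf rE; have ip := bounded_measurable_integrable p bf.
have iq := bounded_measurable_integrable q bf.
rewrite /Rintegral -fineD; [|exact: integrable_fin_num..].
rewrite -integral_measure_add//; congr fine.
by apply: eq_measure_integral => A mA _; apply: etrans (rE _ mA) _; rewrite -measure_addE.
Qed.

Lemma Rintegral_measureZ (a : R) p q f : 0 <= a -> bounded_measurable f ->
  (forall A, measurable A -> q A = (a%:E * p A)%E) ->
  \int[q]_x f x = a * \int[p]_x f x.
Proof.
move=> a0 bf qE; pose k := NngNum a0.
have h g : bounded_measurable g -> (forall x, 0 <= g x) ->
    \int[q]_x g x = a * \int[p]_x g x.
  move=> bg g0; rewrite /Rintegral.
  rewrite (eq_measure_integral (mscale k p)); last by move=> A mA _; exact: qE.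
  rewrite ge0_integral_mscale//.
  - rewrite fineM//; apply: integrable_fin_num => //.
    exact: bounded_measurable_integrable.
  - by apply/measurable_EFinP; case: bg.
  - by move=> x _; rewrite lee_fin.
have [M M0 fM] := bounded_measurable_shift bf.
have bM : bounded_measurable (cst M : T -> R) by exact: bounded_measurable_cst.
have bfM := bounded_measurableD bf bM.
have D r : \int[r]_x f x = \int[r]_x (f x + M) - \int[r]_x M.
  by rewrite RintegralD ?addrK//; exact: bounded_measurable_integrable.
by rewrite !D (h _ bfM)// (h _ bM)// mulrBr.
Qed.

End signed_integral.

Section charge_integral.
Context {R : realType} {S : ptopologicalType}.
Implicit Types (p q : {finite_measure set (borel S) -> \bar R})
  (nu : {charge set (borel S) -> \bar R}) (f : S -> R).

(** The Hahn decomposition is spelled as in [charge_integral], so that [charge_integralE] holds by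
    conversion. *)
Definition charge_pos nu : {finite_measure set (borel S) -> \bar R} :=
  jordan_pos (projT2 (cid (projT2 (cid (Hahn_decomposition nu))))).
Definition charge_neg nu : {finite_measure set (borel S) -> \bar R} :=
  jordan_neg (projT2 (cid (projT2 (cid (Hahn_decomposition nu))))).

Lemma charge_posneg nu A : is_borel A -> nu A = (charge_pos nu A - charge_neg nu A)%E.
Proof.
move=> mA; rewrite (jordan_decomp (projT2 (cid (projT2 (cid (Hahn_decomposition nu))))) mA).
by rewrite /cadd /= /cscale /= EFinN mulN1e.
Qed.

Lemma charge_integralE nu f :
  charge_integral nu f = \int[charge_pos nu]_x f x - \int[charge_neg nu]_x f x.
Proof. by []. Qed.

(** Any decomposition of [nu] computes the integral: p - q = nu+ - nu- means nu+ + q = nu- + p, an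
    equality of positive measures, where integrals add. Linearity in [nu] follows without a look at
    Hahn sets. *)
Lemma charge_integral_pair nu p q f : bounded_measurable (f : borel S -> R) ->
  (forall A, is_borel A -> nu A = (p A - q A)%E) ->
  charge_integral nu f = \int[p]_x f x - \int[q]_x f x.
Proof.
move=> bf nuE; rewrite charge_integralE.
pose r1 := measure_add (charge_pos nu) q.
have fr1 : fin_num_fun r1.
  by move=> A mA; rewrite /r1 measure_addE fin_numD !fin_num_measure.
have r1E A : is_borel A -> finite_measure_of fr1 A = (charge_pos nu A + q A)%E.
  by move=> mA; rewrite -measure_addE.
have := Rintegral_measureD bf r1E.
rewrite (Rintegral_measureD (p := charge_neg nu) (q := p) bf).
  by lra.
move=> A mA; rewrite r1E//; have := nuE A mA; rewrite charge_posneg//.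
rewrite -(fineK (fin_num_measure p A mA)) -(fineK (fin_num_measure q A mA)).
rewrite -(fineK (fin_num_measure (charge_pos nu) A mA)).
rewrite -(fineK (fin_num_measure (charge_neg nu) A mA)).
by rewrite -!EFinD => -[h]; congr (_%:E); lra.
Qed.

Lemma charge_integral_ext nu1 nu2 f : bounded_measurable (f : borel S -> R) ->
  (forall A, is_borel A -> nu1 A = nu2 A) ->
  charge_integral nu1 f = charge_integral nu2 f.
Proof.
move=> bf h; rewrite [RHS]charge_integralE; apply: charge_integral_pair => // A mA.
by rewrite h// charge_posneg.
Qed.

Lemma charge_integralD nu1 nu2 f : bounded_measurable (f : borel S -> R) ->
  charge_integral (cadd nu1 nu2) f = charge_integral nu1 f + charge_integral nu2 f.
Proof.
move=> bf; have mk (m1 m2 : {finite_measure set (borel S) -> \bar R}) :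
    exists r : {finite_measure set (borel S) -> \bar R}, forall A, r A = (m1 A + m2 A)%E.
  have fr : fin_num_fun (measure_add m1 m2).
    by move=> A mA; rewrite measure_addE fin_numD !fin_num_measure.
  by exists (finite_measure_of fr) => A; rewrite -measure_addE.
have [p pE] := mk (charge_pos nu1) (charge_pos nu2).
have [q qE] := mk (charge_neg nu1) (charge_neg nu2).
rewrite (@charge_integral_pair _ p q)//.
  rewrite (Rintegral_measureD (r := p) bf (fun A _ => pE A)).
  rewrite (Rintegral_measureD (r := q) bf (fun A _ => qE A)).
  by rewrite !charge_integralE; lra.
move=> A mA; transitivity (nu1 A + nu2 A)%E => //; rewrite pE qE !charge_posneg//.
rewrite -(fineK (fin_num_measure (charge_pos nu1) A mA)).
rewrite -(fineK (fin_num_measure (charge_neg nu1) A mA)).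
rewrite -(fineK (fin_num_measure (charge_pos nu2) A mA)).
rewrite -(fineK (fin_num_measure (charge_neg nu2) A mA)).
by apply: (congr1 EFin); rewrite opprD addrACA.
Qed.

Lemma charge_integralZ (a : R) nu f : bounded_measurable (f : borel S -> R) ->
  charge_integral (cscale a nu) f = a * charge_integral nu f.
Proof.
move=> bf; have mk (k : {nonneg R}) (m1 : {finite_measure set (borel S) -> \bar R}) :
    exists r : {finite_measure set (borel S) -> \bar R}, forall A, r A = (k%:num%:E * m1 A)%E.
  have fr : fin_num_fun (mscale k m1) by move=> A mA; rewrite fin_numM// fin_num_measure.
  by exists (finite_measure_of fr).
have [a0|a0] := leP 0 a.
  have [p pE] := mk (NngNum a0) (charge_pos nu).
  have [q qE] := mk (NngNum a0) (charge_neg nu).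
  rewrite (@charge_integral_pair _ p q)//.
    rewrite (Rintegral_measureZ (q := p) a0 bf (fun A _ => pE A)).
    rewrite (Rintegral_measureZ (q := q) a0 bf (fun A _ => qE A)).
    by rewrite !charge_integralE; lra.
  move=> A mA; transitivity (a%:E * nu A)%E => //; rewrite pE qE !charge_posneg//.
  rewrite -(fineK (fin_num_measure (charge_pos nu) A mA)).
  rewrite -(fineK (fin_num_measure (charge_neg nu) A mA)).
  by apply: (congr1 EFin); rewrite mulrBr.
(* A negative factor exchanges the positive and the negative part. *)
have a0' : 0 <= - a by lra.
have [p pE] := mk (NngNum a0') (charge_neg nu).
have [q qE] := mk (NngNum a0') (charge_pos nu).
rewrite (@charge_integral_pair _ p q)//.
  rewrite (Rintegral_measureZ (q := p) a0' bf (fun A _ => pE A)).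
  rewrite (Rintegral_measureZ (q := q) a0' bf (fun A _ => qE A)).
  by rewrite !charge_integralE; lra.
move=> A mA; transitivity (a%:E * nu A)%E => //; rewrite pE qE !charge_posneg//.
rewrite -(fineK (fin_num_measure (charge_pos nu) A mA)).
rewrite -(fineK (fin_num_measure (charge_neg nu) A mA)).
by apply: (congr1 EFin); rewrite /=; lra.
Qed.

End charge_integral.

Section normc.
Context {R : realType}.
Implicit Types z : R[i].

Lemma normc_ge0 z : 0 <= normc z.
Proof. by case: z => a b; exact: sqrtr_ge0. Qed.

Lemma normc_real (a : R) : normc (Complex a 0) = `|a|.
Proof. by rewrite /= expr0n /= addr0 sqrtr_sqr. Qed.

Lemma normc_imag (a : R) : normc (Complex 0 a) = `|a|.
Proof. by rewrite /= expr0n /= add0r sqrtr_sqr. Qed.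

Lemma le_normc_Re z : `|Re z| <= normc z.
Proof. by case: z => a b /=; rewrite -sqrtr_sqr ler_wsqrtr// lerDl sqr_ge0. Qed.

Lemma le_normc_Im z : `|Im z| <= normc z.
Proof. by case: z => a b /=; rewrite -sqrtr_sqr ler_wsqrtr// lerDr sqr_ge0. Qed.

Lemma le_normc_ReIm z : normc z <= `|Re z| + `|Im z|.
Proof.
case: z => a b; have -> : Complex a b = Complex a 0 + Complex 0 b.
  by apply/eqP; rewrite eq_complex /= addr0 add0r !eqxx.
by apply: le_trans (le_normcD _ _) _; rewrite normc_real normc_imag /= addr0 add0r.
Qed.

End normc.

(** * Complex measures as combinations of four positive regular measures *)

Section positive_cmeasure.
Context {R : realType} {S : ptopologicalType}.
Hypothesis hS : hausdorff_space S.
Implicit Types (p q : {finite_measure set (borel S) -> \bar R}) (mu nu : cmeasure R S).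

Definition cm_fun (p : set (borel S) -> \bar R) (A : set S) : R[i] :=
  if `[< is_borel A >] then Complex (fine (p A)) 0 else 0.

Lemma cm_funE p A : is_borel A -> cm_fun p A = Complex (fine (p A)) 0.
Proof. by move=> bA; rewrite /cm_fun asboolT. Qed.

Lemma tvar_cm_fun p A : is_borel A -> (tvar (cm_fun p) A <= p A)%E.
Proof.
move=> bA; apply: ge_ereal_sup => _ [n [F [bF FA tF ->]]].
have bU : measurable (\big[setU/set0]_(i < n) F i : set (borel S)).
  by apply: bigsetU_measurable => i _; exact: bF.
apply: (@le_trans _ _ (p (\big[setU/set0]_(i < n) F i))).
  rewrite measure_semi_additive_ord// -sumEFin.
  apply: lee_sum => i _; rewrite cm_funE// normc_real ger0_norm ?fine_ge0//.
  by rewrite fineK//; apply: fin_num_measure; exact: bF.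
apply: le_measure; rewrite ?inE//.
by apply: (big_ind (fun B => B `<=` A)) => // B C BA CA; rewrite subUset.
Qed.

Lemma is_cmeasure_cm_fun p : regular_measure p -> is_cmeasure (cm_fun p).
Proof.
move=> rp.
have rE A : is_borel A -> repart (cm_fun p) A = p A.
  by move=> bA; rewrite /repart cm_funE//= fineK// fin_num_measure.
have iE A : impart (cm_fun p) A = 0%E.
  by rewrite /impart /cm_fun; case: ifP.
split.
- by move=> A nA; rewrite /cm_fun asboolF.
- by rewrite cm_funE ?measure0//; exact: measurable0.
- move=> F mF tF mUF; rewrite rE//.
  rewrite [X in X @ _ --> _](_ : _ = fun n => (\sum_(0 <= i < n) p (F i))%E).
    exact: measure_semi_sigma_additive.
  by apply/funext => n; apply: eq_bigr => i _; rewrite rE//; exact: mF.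
- move=> F _ _ _; rewrite iE [X in X @ _ --> _](_ : _ = fun=> 0%E).
    exact: cvg_cst.
  by apply/funext => n; rewrite big1.
- move=> A e bA e0; have [K [U [cK oU KA AU UK]]] := rp A e bA e0.
  exists K, U; split => //; apply: le_lt_trans UK; apply: tvar_cm_fun.
  by apply: measurableD; [exact: open_borel|exact: compact_borel].
Qed.

Lemma cm_fun_in p : regular_measure p -> cm_fun p \in cmeasure_pred R S.
Proof. by move=> rp; rewrite inE; exact: is_cmeasure_cm_fun. Qed.

Definition cm p (rp : regular_measure p) : cmeasure R S := CMeasure (cm_fun_in rp).

Lemma cmE p (rp : regular_measure p) A : is_borel A -> cm rp A = Complex (fine (p A)) 0.
Proof. exact: cm_funE. Qed.

Lemma cmeasure_ext mu nu : (forall A, is_borel A -> mu A = nu A) -> mu = nu.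
Proof.
move=> h; apply/val_inj/funext => A; have [|nA] := pselect (is_borel A); first exact: h.
have [h1 _ _ _ _] := cmeasureP mu; have [h2 _ _ _ _] := cmeasureP nu.
by rewrite /= h1// h2.
Qed.

Lemma le_normc_tvar mu A : is_borel A -> ((normc (mu A))%:E <= tvar mu A)%E.
Proof.
move=> bA; apply: ereal_sup_ubound; exists 1%N, (fun=> A); split => //.
- by move=> _.
- by move=> i j _ _ _; rewrite (ord1 i) (ord1 j).
- by rewrite big_ord_recl big_ord0 addr0.
Qed.

Definition re mu := recharge (cmeasureP mu).
Definition im mu := imcharge (cmeasureP mu).

Lemma reE mu A : re mu A = (Re (mu A))%:E. Proof. by []. Qed.
Lemma imE mu A : im mu A = (Im (mu A))%:E. Proof. by []. Qed.

(** The Jordan parts are, up to sign, restrictions of [nu] to Borel sets. This bounds them by the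
    total variation of the complex measure, from which they inherit regularity ([regular_tvar]) and
    so belong to M(S) themselves. *)
Lemma charge_pos_sub (nu : {charge set (borel S) -> \bar R}) : exists P N : set S,
  [/\ is_borel P, is_borel N,
   forall A, is_borel A -> charge_pos nu A = nu (A `&` P) &
   forall A, is_borel A -> charge_neg nu A = (- nu (A `&` N))%E].
Proof.
rewrite /charge_pos /charge_neg.
exists (projT1 (cid (Hahn_decomposition nu))).
exists (projT1 (cid (projT2 (cid (Hahn_decomposition nu))))).
move: (projT2 (cid (projT2 (cid (Hahn_decomposition nu))))) => PN.
have [[bP _] [bN _] _ _] := PN.
split => // A bA.
- by rewrite -[LHS]/(jordan_pos PN A) jordan_posE cjordan_posE /crestr0 mem_set.
- by rewrite -[LHS]/(jordan_neg PN A) jordan_negE cjordan_negE /crestr0 mem_set.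
Qed.

Lemma charge_part_tvar mu (nu : {charge set (borel S) -> \bar R}) :
  (forall A, is_borel A -> `|nu A| <= tvar mu A)%E ->
  forall A, is_borel A -> (charge_pos nu A <= tvar mu A)%E /\ (charge_neg nu A <= tvar mu A)%E.
Proof.
move=> h A bA; have [P [N [bP bN pE nE]]] := charge_pos_sub nu.
split.
  rewrite pE//; apply: le_trans (lee_abs _) _; apply: le_trans (h _ _) _.
    exact: measurableI.
  exact: tvar_subset.
rewrite nE//; apply: le_trans (lee_abs _) _; rewrite abseN; apply: le_trans (h _ _) _.
  exact: measurableI.
exact: tvar_subset.
Qed.

Lemma regular_tvar mu p : (forall A, is_borel A -> (p A <= tvar mu A)%E) ->
  regular_measure p.
Proof.
move=> pmu A e bA e0; have [_ _ _ _ rmu] := cmeasureP mu.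
have [K [U [cK oU KA AU UK]]] := rmu A e bA e0.
exists K, U; split => //; apply: le_lt_trans UK; apply: pmu.
by apply: measurableD; [exact: open_borel|exact: compact_borel].
Qed.

Lemma cmeasure_linE (a : R[i]) mu nu A : (a *: mu + nu) A = a * mu A + nu A.
Proof. by []. Qed.

Lemma cmeasureDE mu nu A : (mu + nu) A = mu A + nu A.
Proof. by []. Qed.

Lemma cmeasureNE mu A : (- mu) A = - mu A.
Proof. by []. Qed.

Lemma cmeasureZE (a : R[i]) mu A : (a *: mu) A = a * mu A.
Proof. by []. Qed.

Lemma cmeasure0E A : (0 : cmeasure R S) A = 0.
Proof. by []. Qed.

Lemma tvar_cmE p (rp : regular_measure p) A : is_borel A -> tvar (cm rp) A = p A.
Proof.
move=> bA; apply/eqP; rewrite eq_le tvar_cm_fun//=.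
apply: le_trans (le_normc_tvar (cm rp) bA); rewrite cmE// normc_real ger0_norm ?fine_ge0//.
by rewrite fineK//; exact: fin_num_measure.
Qed.

Lemma cmeasure_parts mu : exists q1 q2 q3 q4 : {finite_measure set (borel S) -> \bar R},
  [/\ forall A, is_borel A -> (q1 A <= tvar mu A)%E,
      forall A, is_borel A -> (q2 A <= tvar mu A)%E,
      forall A, is_borel A -> (q3 A <= tvar mu A)%E,
      forall A, is_borel A -> (q4 A <= tvar mu A)%E &
      forall A, is_borel A -> mu A =
        Complex (fine (q1 A) - fine (q2 A)) (fine (q3 A) - fine (q4 A))].
Proof.
have hr A : is_borel A -> (`|re mu A| <= tvar mu A)%E.
  move=> bA; apply: le_trans (le_normc_tvar mu bA).
  by rewrite reE lee_fin; exact: le_normc_Re.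
have hi A : is_borel A -> (`|im mu A| <= tvar mu A)%E.
  move=> bA; apply: le_trans (le_normc_tvar mu bA).
  by rewrite imE lee_fin; exact: le_normc_Im.
exists (charge_pos (re mu)), (charge_neg (re mu)), (charge_pos (im mu)),
  (charge_neg (im mu)); split.
- by move=> A bA; have [] := charge_part_tvar hr bA.
- by move=> A bA; have [] := charge_part_tvar hr bA.
- by move=> A bA; have [] := charge_part_tvar hi bA.
- by move=> A bA; have [] := charge_part_tvar hi bA.
have h (nu : {charge set (borel S) -> \bar R}) A : is_borel A ->
    fine (nu A) = fine (charge_pos nu A) - fine (charge_neg nu A).
  by move=> bA; rewrite charge_posneg// fineB//; exact: fin_num_measure.
by move=> A bA; rewrite -!h// reE imE /=; case: (mu A).
Qed.

(** The four positive parts have finite mass, and their sum bounds every partition sum. Hence [fine]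
    loses nothing in the definition of [tvnorm]. *)
Lemma tvar_fin mu : tvar mu setT \is a fin_num.
Proof.
rewrite ge0_fin_numE ?tvar_ge0//.
have [q1 [q2 [q3 [q4 [_ _ _ _ muE]]]]] := cmeasure_parts mu.
pose F (q : {finite_measure set (borel S) -> \bar R}) := fine (q setT).
apply: (@le_lt_trans _ _ (F q1 + F q2 + (F q3 + F q4))%:E); last exact: ltry.
apply: ge_ereal_sup => _ [n [A [bA AT tA ->]]]; rewrite lee_fin.
have h (q : {finite_measure set (borel S) -> \bar R}) :
    \sum_(i < n) fine (q (A i)) <= F q.
  have bU : measurable (\big[setU/set0]_(i < n) A i : set (borel S)).
    by apply: bigsetU_measurable => i _; exact: bA.
  apply: (@le_trans _ _ (fine (q (\big[setU/set0]_(i < n) A i)))).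
    rewrite measure_semi_additive_ord// -lee_fin fineK; last first.
      by rewrite sum_fin_num; apply/allP => x /mapP[i _ ->]; apply: fin_num_measure; exact: bA.
    rewrite -sumEFin; apply: lee_sum => i _.
    by rewrite fineK//; apply: fin_num_measure; exact: bA.
  exact: fine_le_measure.
apply: (@le_trans _ _ (\sum_(i < n) (fine (q1 (A i)) + fine (q2 (A i)) +
    (fine (q3 (A i)) + fine (q4 (A i)))))); last first.
  by rewrite !big_split /=; rewrite !lerD.
apply: ler_sum => i _; rewrite muE; last exact: bA.
apply: le_trans (le_normc_ReIm _) _ => /=.
by rewrite lerD// (le_trans (ler_normB _ _))// !ger0_norm ?fine_ge0.
Qed.

Lemma tvnormE mu : tvar mu setT = (tvnorm mu)%:E.
Proof. by rewrite /tvnorm fineK// tvar_fin. Qed.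

Lemma tvnorm_ge0 mu : 0 <= tvnorm mu.
Proof. by rewrite -lee_fin -tvnormE tvar_ge0. Qed.

Lemma tvnorm_lin (a : R[i]) mu nu :
  tvnorm (a *: mu + nu) <= normc a * tvnorm mu + tvnorm nu.
Proof.
rewrite -lee_fin -tvnormE EFinD EFinM -!tvnormE; exact: tvar_lin.
Qed.

Lemma tvnorm0 : tvnorm (0 : cmeasure R S) = 0.
Proof.
apply/eqP; rewrite eq_le tvnorm_ge0 andbT -lee_fin -tvnormE.
apply: ge_ereal_sup => _ [n [A [_ _ _ ->]]].
by rewrite big1// => i _; rewrite cmeasure0E ComplexField.Normc.normc0.
Qed.

Lemma tvnormZ (a : R[i]) mu : tvnorm (a *: mu) <= normc a * tvnorm mu.
Proof. by have := tvnorm_lin a mu 0; rewrite addr0 tvnorm0 addr0. Qed.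

Lemma tvnormD mu nu : tvnorm (mu + nu) <= tvnorm mu + tvnorm nu.
Proof.
by have := tvnorm_lin 1 mu nu; rewrite scale1r ComplexField.Normc.normc1 mul1r.
Qed.

Lemma tvnormN mu : tvnorm (- mu) <= tvnorm mu.
Proof.
have := tvnormZ (-1) mu; rewrite scaleN1r.
suff -> : normc (-1 : R[i]) = 1 by rewrite mul1r.
by rewrite (normcN (1 : Rcomplex R)) ComplexField.Normc.normc1.
Qed.

Lemma tvnormB mu nu : tvnorm (mu - nu) <= tvnorm mu + tvnorm nu.
Proof. by apply: le_trans (tvnormD _ _) _; rewrite lerD2l tvnormN. Qed.

Lemma le_normc_tvnorm mu : normc (mu setT) <= tvnorm mu.
Proof. by rewrite -lee_fin -tvnormE; apply: le_normc_tvar; exact: measurableT. Qed.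

Lemma positive_cm p (rp : regular_measure p) : positive_measure (cm rp).
Proof. by move=> A bA; rewrite cmE// lecE /= eqxx fine_ge0. Qed.

Lemma tvnorm_cm p (rp : regular_measure p) : tvnorm (cm rp) = fine (p setT).
Proof. by rewrite /tvnorm tvar_cmE//; exact: measurableT. Qed.

Lemma positive_cmP mu : positive_measure mu ->
  exists p (rp : regular_measure p), mu = cm rp.
Proof.
move=> mu0; have re0 A : (0 <= re mu A)%E.
  rewrite reE lee_fin; have [/mu0|nA] := pselect (is_borel A).
    by rewrite lecE => /andP[].
  by have [h _ _ _ _] := cmeasureP mu; rewrite h.
pose p0 : {measure set (borel S) -> \bar R} := measure_of_charge (re mu) re0.
have fp : fin_num_fun p0 by [].
pose p := finite_measure_of fp.
have rp : regular_measure p.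
  apply: (@regular_tvar mu) => A bA; apply: le_trans (le_normc_tvar mu bA).
  rewrite -[p A]/(re mu A) reE lee_fin; apply: le_trans (le_normc_Re _).
  exact: ler_norm.
exists p, rp; apply: cmeasure_ext => A bA; rewrite cmE//.
have := mu0 A bA; rewrite lecE => /andP[/eqP i0 _].
by rewrite -[p A]/(re mu A) reE /= -[X in Complex _ X]i0; case: (mu A).
Qed.

Lemma cmeasure_decomp mu : exists q1 q2 q3 q4 : cmeasure R S,
  [/\ positive_measure q1 /\ tvnorm q1 <= tvnorm mu,
   positive_measure q2 /\ tvnorm q2 <= tvnorm mu,
   positive_measure q3 /\ tvnorm q3 <= tvnorm mu,
   positive_measure q4 /\ tvnorm q4 <= tvnorm mu &
   mu = (q1 - q2) + 'i%C *: (q3 - q4)].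
Proof.
have [p1 [p2 [p3 [p4 [l1 l2 l3 l4 muE]]]]] := cmeasure_parts mu.
have h p (lp : forall A, is_borel A -> (p A <= tvar mu A)%E) :
    positive_measure (cm (regular_tvar lp)) /\ tvnorm (cm (regular_tvar lp)) <= tvnorm mu.
  split; first exact: positive_cm.
  rewrite tvnorm_cm -lee_fin -tvnormE fineK; last exact: fin_num_measure.
  by apply: lp; exact: measurableT.
exists (cm (regular_tvar l1)), (cm (regular_tvar l2)), (cm (regular_tvar l3)),
  (cm (regular_tvar l4)); split; [exact: h..|].
apply: cmeasure_ext => A bA; rewrite muE//.
rewrite cmeasureDE cmeasureZE !cmeasureDE !cmeasureNE !cmE//.
by apply/eqP; rewrite eq_complex /=; apply/andP; split; apply/eqP; ring.
Qed.

(** Lets a property that is stable under linear combinations be checked on positive regular measures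
    only. *)
Lemma cmeasure_ind (P : cmeasure R S -> Prop) :
  (forall a mu nu, P mu -> P nu -> P (a *: mu + nu)) ->
  (forall p (rp : regular_measure p), P (cm rp)) -> forall mu, P mu.
Proof.
move=> Plin Pcm mu.
have [q1 [q2 [q3 [q4 [[p1 _] [p2 _] [p3 _] [p4 _] ->]]]]] := cmeasure_decomp mu.
have Pq (q : cmeasure R S) : positive_measure q -> P q by move=> /positive_cmP[p [rp ->]].
have PB (q r : cmeasure R S) : P q -> P r -> P (q - r).
  by move=> Hq Hr; rewrite addrC -scaleN1r; apply: Plin.
by rewrite addrC; apply: Plin; apply: PB; exact: Pq.
Qed.

Lemma positive_tvnorm mu : positive_measure mu -> mu setT = Complex (tvnorm mu) 0.
Proof.
move=> /positive_cmP[p [rp ->]]; rewrite tvnorm_cm cmE//; exact: measurableT.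
Qed.

Lemma M0_tvnorm mu : M0 mu -> tvnorm mu = 1.
Proof. by move=> [p1 h]; have := positive_tvnorm p1; rewrite h => -[]. Qed.

Lemma positive_real A mu : positive_measure mu -> Im (mu A) = 0.
Proof.
move=> mu0; have [/mu0|nA] := pselect (is_borel A).
  by rewrite lecE => /andP[/eqP].
by have [h _ _ _ _] := cmeasureP mu; rewrite h.
Qed.

Lemma positiveD mu nu : positive_measure mu -> positive_measure nu ->
  positive_measure (mu + nu).
Proof. by move=> h1 h2 A bA; rewrite cmeasureDE addr_ge0// ?h1// h2. Qed.

End positive_cmeasure.

(** * Bilinearity of the integral, and uniqueness in the Riesz representation *)

Section cintegral.
Context {R : realType} {S : ptopologicalType}.
Implicit Types (mu nu lambda : cmeasure R S) (f g : S -> R[i])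
  (p q : {finite_measure set (borel S) -> \bar R}).

Definition cbounded f := bounded_measurable (fun x : borel S => Re (f x)) /\
  bounded_measurable (fun x : borel S => Im (f x)).

Definition ccontinuous f := [/\ continuous (fun x => Re (f x)),
  continuous (fun x => Im (f x)) & exists M, forall x, normc (f x) <= M].

Lemma ccontinuous_bounded f : ccontinuous f -> cbounded f.
Proof.
move=> [cr ci [M fM]]; split; apply: continuous_bounded_measurable => //; exists M => x.
  exact: le_trans (le_normc_Re _) (fM x).
exact: le_trans (le_normc_Im _) (fM x).
Qed.

Lemma ccontinuous_lin (a : R[i]) f g : ccontinuous f -> ccontinuous g ->
  ccontinuous (fun x => a * f x + g x).
Proof.
move=> [fr fi [M fM]] [gr gi [N gN]]; split.
- rewrite (_ : (fun x => _) =
    (fun x => Re a * Re (f x) - Im a * Im (f x) + Re (g x))); last first.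
    by apply/funext => x; case: (a) (f x) (g x) => [? ?] [? ?] [? ?].
  move=> x; apply: cvgD; last exact: gr.
  by apply: cvgB; apply: cvgM; [exact: cvg_cst|exact: fr|exact: cvg_cst|exact: fi].
- rewrite (_ : (fun x => _) =
    (fun x => Re a * Im (f x) + Im a * Re (f x) + Im (g x))); last first.
    by apply/funext => x; case: (a) (f x) (g x) => [? ?] [? ?] [? ?].
  move=> x; apply: cvgD; last exact: gi.
  by apply: cvgD; apply: cvgM; [exact: cvg_cst|exact: fi|exact: cvg_cst|exact: fr].
- exists (normc a * M + N) => x; apply: le_trans (le_normcD _ _) _.
  by rewrite ComplexField.Normc.normcM lerD// ler_wpM2l// normc_ge0.
Qed.

Lemma cintegral_linl (a : R[i]) mu nu f : cbounded f ->
  cintegral (a *: mu + nu) f = a * cintegral mu f + cintegral nu f.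
Proof.
move=> [br bi]; pose a1 := Re a; pose a2 := Im a.
have rE h : bounded_measurable (h : borel S -> R) -> charge_integral (re (a *: mu + nu)) h =
    a1 * charge_integral (re mu) h - a2 * charge_integral (im mu) h + charge_integral (re nu) h.
  move=> bh; rewrite -mulNr -!charge_integralZ// -!charge_integralD//.
  apply: charge_integral_ext => // A bA.
  transitivity (a1%:E * re mu A + (- a2)%:E * im mu A + re nu A)%E => //.
  rewrite !reE imE cmeasure_linE -!EFinM -!EFinD; congr (_%:E).
  by rewrite /a1 /a2; case: (a) (mu A) (nu A) => [? ?] [? ?] [? ?] /=; rewrite mulNr.
have iE h : bounded_measurable (h : borel S -> R) -> charge_integral (im (a *: mu + nu)) h =
    a1 * charge_integral (im mu) h + a2 * charge_integral (re mu) h + charge_integral (im nu) h.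
  move=> bh; rewrite -!charge_integralZ// -!charge_integralD//.
  apply: charge_integral_ext => // A bA.
  transitivity (a1%:E * im mu A + a2%:E * re mu A + im nu A)%E => //.
  rewrite !imE reE cmeasure_linE -!EFinM -!EFinD; congr (_%:E).
  by rewrite /a1 /a2; case: (a) (mu A) (nu A) => [? ?] [? ?] [? ?] /=.
rewrite /cintegral -!/(re _) -!/(im _) !rE// !iE// /a1 /a2; case: (a) => x y /=.
by apply/eqP; rewrite eq_complex /=; apply/andP; split; apply/eqP; ring.
Qed.

Lemma mzero_finite : fin_num_fun (mzero : {measure set (borel S) -> \bar R}).
Proof. by []. Qed.

Lemma charge_integral_measure (nu : {charge set (borel S) -> \bar R})
    (p : {finite_measure set (borel S) -> \bar R}) (f : S -> R) :
  bounded_measurable (f : borel S -> R) -> (forall A, is_borel A -> nu A = p A) ->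
  charge_integral nu f = \int[p]_x f x.
Proof.
move=> bf nuE; rewrite (@charge_integral_pair _ _ _ p (finite_measure_of mzero_finite))//.
  rewrite [X in _ - X](_ : _ = 0) ?subr0// /Rintegral.
  by rewrite integral_measure_zero.
by move=> A bA; rewrite nuE// [X in (_ - X)%E](_ : _ = 0%E) ?sube0.
Qed.

Lemma cintegral_cmE (hS : hausdorff_space S) p (rp : regular_measure p) f : cbounded f ->
  cintegral (cm hS rp) f = Complex (\int[p]_x Re (f x)) (\int[p]_x Im (f x)).
Proof.
move=> [br bi]; rewrite /cintegral -!/(re _) -!/(im _).
have rE h : bounded_measurable (h : borel S -> R) ->
    charge_integral (re (cm hS rp)) h = \int[p]_x h x.
  move=> bh; apply: charge_integral_measure => // A bA.
  by rewrite reE cmE//= fineK//; exact: fin_num_measure.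
have iE h : bounded_measurable (h : borel S -> R) ->
    charge_integral (im (cm hS rp)) h = 0.
  move=> bh; rewrite (@charge_integral_measure _ (finite_measure_of mzero_finite))//.
    by rewrite /Rintegral integral_measure_zero.
  by move=> A bA; rewrite imE cmE.
by rewrite !rE// !iE// subr0 addr0.
Qed.

Hypothesis hS : hausdorff_space S.

Lemma cintegral_linr mu (a : R[i]) f g : cbounded f -> cbounded g ->
  cintegral mu (fun x => a * f x + g x) = a * cintegral mu f + cintegral mu g.
Proof.
move=> bf bg; have [fr fi] := bf; have [gr gi] := bg.
have reE : (fun x => Re (a * f x + g x)) = (fun x => Re a * Re (f x) - Im a * Im (f x) + Re (g x)).
  by apply/funext => x; case: (a) (f x) (g x) => [? ?] [? ?] [? ?].
have imE : (fun x => Im (a * f x + g x)) = (fun x => Re a * Im (f x) + Im a * Re (f x) + Im (g x)).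
  by apply/funext => x; case: (a) (f x) (g x) => [? ?] [? ?] [? ?].
have bfg : cbounded (fun x => a * f x + g x).
  split; rewrite ?reE ?imE; apply: bounded_measurableD => //.
    by apply: bounded_measurableB; exact: bounded_measurableZ.
  by apply: bounded_measurableD; exact: bounded_measurableZ.
elim/(@cmeasure_ind R S hS) : mu => [b mu nu hmu hnu|p rp].
  by rewrite !cintegral_linl// hmu hnu; ring.
rewrite !cintegral_cmE// reE imE.
have ib (h : S -> R) : bounded_measurable (h : borel S -> R) ->
  p.-integrable setT (EFin \o (h : borel S -> R)) by exact: bounded_measurable_integrable.
have bZ c (h : S -> R) : bounded_measurable (h : borel S -> R) ->
  bounded_measurable ((fun x => c * h x) : borel S -> R) by exact: bounded_measurableZ.
rewrite RintegralD//; last 2 first.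
- by apply: ib; apply: bounded_measurableB; exact: bZ.
- exact: ib.
rewrite RintegralB//; [|by apply: ib; exact: bZ..].
rewrite RintegralD//; last 2 first.
- by apply: ib; apply: bounded_measurableD; exact: bZ.
- exact: ib.
rewrite RintegralD//; [|by apply: ib; exact: bZ..].
rewrite !RintegralZl//; [|exact: ib..].
by case: (a) => a1 a2; apply/eqP; rewrite eq_complex /= !eqxx.
Qed.

Hypothesis lcS : locally_compact [set: S].

(** If q A < t < p A, take a compact K inside A with p K > t and an open U around A with q U < t. A
    bump f between them, vanishing off a compact C inside U, gives p K <= int f dp = int f dq <= q C
    <= q U, a contradiction. *)
Lemma regular_measure_le p q : regular_measure p -> regular_measure q ->
  (forall (C : set S) (f : S -> R), compact C -> continuous f ->
    (forall x, 0 <= f x <= 1) -> (forall x, ~ C x -> f x = 0) ->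
    \int[p]_x f x = \int[q]_x f x) ->
  forall A, is_borel A -> (p A <= q A)%E.
Proof.
move=> rp rq pq A bA; rewrite leNgt; apply/negP => qp.
have qp' : fine (q A) < fine (p A).
  by rewrite -lt_fine_measure// fineK//; exact: fin_num_measure.
have [t] : exists t, fine (q A) < t < fine (p A).
  by exists ((fine (q A) + fine (p A)) / 2); rewrite !midf_lt.
move=> /andP[]; rewrite -(lt_fine_measure q)// -(gt_fine_measure p)// => qt tp.
have [K [cK KA] tK] := regular_inner hS rp bA tp.
have [U [oU AU] Ut] := regular_outer hS rq bA qt.
have [C [f [cC CU cf f01 [f1 f0]]]] := lc_urysohn R hS lcS cK oU (subset_trans KA AU).
have bf : bounded_measurable (f : borel S -> R).
  apply: continuous_bounded_measurable => //; exists 1 => x.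
  by have /andP[a b] := f01 x; rewrite ger0_norm.
have bK := compact_borel hS cK; have bC := compact_borel hS cC.
have : (p K <= q C)%E.
  apply: (@le_trans _ _ (\int[p]_x f x)%:E).
    apply: measure_le_integral => // x; rewrite indicE.
    by case: (boolP (x \in K)) => [/set_mem/f1 ->//|_]; have /andP[] := f01 x.
  rewrite (pq C)//; apply: integral_le_measure => // x; rewrite indicE.
  case: (boolP (x \in C)) => [_|/negP nC]; first by have /andP[] := f01 x.
  by rewrite f0// => Cx; apply: nC; apply/mem_set.
apply/negP; rewrite -ltNge; apply: le_lt_trans (lt_trans Ut tK).
by apply: le_measure; rewrite ?inE//; exact: open_borel.
Qed.

Lemma C0_real (C : set S) (f : S -> R) : compact C -> continuous f ->
  (forall x, ~ C x -> f x = 0) -> C0 (fun x => Complex (f x) 0).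
Proof.
move=> cC cf f0; split => //=; first by move=> x; exact: cvg_cst.
move=> e e0; apply: (subclosed_compact _ cC).
  rewrite (_ : [set x | _] = (fun x => `|f x|) @^-1` [set r | e <= r]); last first.
    by apply/funext => x /=; rewrite -normc_real.
  apply: closed_comp; last exact: closed_ge.
  by move=> x _; apply: cvg_norm; exact: cf.
move=> x /= ex; apply: contrapT => /f0 fx.
by move: ex; rewrite fx expr0n /= addr0 sqrtr0; lra.
Qed.

Lemma C0_ccontinuous g : C0 g -> ccontinuous g.
Proof.
move=> [gr gi gc]; split => //.
have bnd (h : S -> R) : continuous h -> exists M, forall x, 1 <= normc (g x) -> `|h x| <= M.
  move=> ch; have cK := gc 1 ltr01.
  have : compact (h @` [set x | 1 <= normc (g x)]).
    by apply: continuous_compact => //; exact: continuous_subspaceT.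
  move=> /compact_bounded[M [_ hM]]; exists (M + 1) => x gx.
  by apply: (hM (M + 1)); [lra|exists x].
have [M hM] := bnd _ gr; have [N hN] := bnd _ gi.
exists (`|M| + `|N| + 1) => x; have [x1|x1] := leP 1 (normc (g x)); last first.
  by apply: (le_trans (ltW x1)); rewrite lerDr addr_ge0.
apply: le_trans (le_normc_ReIm _) _; rewrite -[leLHS]addr0 lerD// lerD//.
  exact: le_trans (hM _ x1) (ler_norm _).
exact: le_trans (hN _ x1) (ler_norm _).
Qed.

(** Real test functions separate the real and the imaginary part of the integral against the
    difference. Within each part the two positive measures then have equal integrals, hence coincide
    by regularity and cancel. *)
Lemma cintegral_inj mu nu : (forall g, C0 g -> cintegral mu g = cintegral nu g) -> mu = nu.
Proof.
move=> h; apply/eqP; rewrite -subr_eq0; apply/eqP; set lambda := mu - nu.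
have l0 g : C0 g -> cintegral lambda g = 0.
  move=> Cg; have bg := ccontinuous_bounded (C0_ccontinuous Cg).
  rewrite /lambda addrC -scaleN1r cintegral_linl// h//; ring.
have [q1 [q2 [q3 [q4 [[p1 _] [p2 _] [p3 _] [p4 _] lE]]]]] := cmeasure_decomp hS lambda.
have [m1 [r1 q1E]] := positive_cmP hS p1; have [m2 [r2 q2E]] := positive_cmP hS p2.
have [m3 [r3 q3E]] := positive_cmP hS p3; have [m4 [r4 q4E]] := positive_cmP hS p4.
have intE C (f : S -> R) : compact C -> continuous f -> (forall x, 0 <= f x <= 1) ->
    (forall x, ~ C x -> f x = 0) ->
    \int[m1]_x f x = \int[m2]_x f x /\ \int[m3]_x f x = \int[m4]_x f x.
  move=> cC cf f01 f0; have Cg := C0_real cC cf f0.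
  have bg := ccontinuous_bounded (C0_ccontinuous Cg).
  (* Every node has the shape [a *: mu + nu] that [cintegral_linl] expects. *)
  have lE' : lambda = 'i%C *: (-1 *: q4 + q3) + (-1 *: q2 + q1).
    by rewrite lE !scaleN1r addrC (addrC q1) (addrC q3).
  have := l0 _ Cg; rewrite lE' !cintegral_linl//.
  rewrite q1E q2E q3E q4E !cintegral_cmE//= => /eqP.
  have z0 (m : {finite_measure set (borel S) -> \bar R}) : \int[m]_x (0 : R) = 0.
    by rewrite Rintegral_cst// mul0r.
  rewrite !z0 eq_complex /= => /andP[/eqP a1 /eqP a2].
  by split; lra.
have e12 A : is_borel A -> m1 A = m2 A.
  move=> bA; apply/eqP; rewrite eq_le; apply/andP; split; apply: regular_measure_le => // C f *.
    by have [] := intE C f.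
  by have [] := intE C f.
have e34 A : is_borel A -> m3 A = m4 A.
  move=> bA; apply/eqP; rewrite eq_le; apply/andP; split; apply: regular_measure_le => // C f *.
    by have [] := intE C f.
  by have [] := intE C f.
apply: cmeasure_ext => A bA.
rewrite lE q1E q2E q3E q4E cmeasureDE cmeasureZE !cmeasureDE !cmeasureNE !cmE//.
by rewrite e12// e34// !subrr mulr0 addr0 cmeasure0E.
Qed.

End cintegral.

(** * Convolution of complex measures *)

Section measure_conv.
Context {R : realType} {S : ptopologicalType} (mul : S -> S -> S).
Hypotheses (hS : hausdorff_space S) (lcS : locally_compact [set: S]).
Hypothesis sc : separately_continuous mul.
Implicit Types (mu nu lambda : cmeasure R S) (f g : S -> R[i])
  (p q : {finite_measure set (borel S) -> \bar R}).

Lemma ccontinuous_translate g y : ccontinuous g -> ccontinuous (fun x => g (mul x y)).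
Proof.
move=> [gr gi [M gM]]; split; last by exists M => x; exact: gM.
- move=> x; apply: (@continuous_comp _ _ _ (mul^~ y) (fun x => Re (g x))); last exact: gr.
  exact: (proj2 sc).
- move=> x; apply: (@continuous_comp _ _ _ (mul^~ y) (fun x => Im (g x))); last exact: gi.
  exact: (proj2 sc).
Qed.

Lemma translate_integral_bounded p (f : S -> R) : continuous f ->
  (exists M, forall x, `|f x| <= M) -> exists M, forall y, `|\int[p]_x f (mul x y)| <= M.
Proof.
move=> cf [M fM]; exists (M * fine (p setT)) => y.
have bf : bounded_measurable ((fun x => f (mul x y)) : borel S -> R).
  apply: continuous_bounded_measurable; last by exists M => x; exact: fM.
  move=> x; apply: (@continuous_comp _ _ _ (mul^~ y) f); last exact: cf.
  exact: (proj2 sc).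
apply: le_trans (le_normr_Rintegral _ _) _ => //.
  exact: (bounded_measurable_integrable p bf).
rewrite -Rintegral_cst//; apply: le_Rintegral => //.
- by apply: bounded_measurable_integrable; exact: bounded_measurable_norm.
- exact: finite_measure_integrable_cst.
Qed.

(** Makes the outer integrand of the convolution formula bounded and continuous, without which
    linearity of the outer integral could not be used. *)
Lemma ccontinuous_cintegral mu g : ccontinuous g ->
  ccontinuous (fun y => cintegral mu (fun x => g (mul x y))).
Proof.
move=> cg; have bg y := ccontinuous_bounded (ccontinuous_translate y cg).
elim/(@cmeasure_ind R S hS) : mu => [a mu nu hmu hnu|p rp].
  rewrite (_ : (fun y => _) = (fun y => a * cintegral mu (fun x => g (mul x y)) +
    cintegral nu (fun x => g (mul x y)))); first exact: ccontinuous_lin.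
  by apply/funext => y; rewrite cintegral_linl.
have [gr gi [M gM]] := cg.
have br : exists M, forall x, `|Re (g x)| <= M.
  by exists M => x; exact: le_trans (le_normc_Re _) (gM x).
have bi : exists M, forall x, `|Im (g x)| <= M.
  by exists M => x; exact: le_trans (le_normc_Im _) (gM x).
rewrite (_ : (fun y => _) = (fun y => Complex (\int[p]_x Re (g (mul x y)))
  (\int[p]_x Im (g (mul x y))))); last by apply/funext => y; rewrite cintegral_cmE.
split.
- exact: (continuous_translate_integral hS lcS sc rp gr br).
- exact: (continuous_translate_integral hS lcS sc rp gi bi).
- have [Mr hr] := translate_integral_bounded p gr br.
  have [Mi hi] := translate_integral_bounded p gi bi.
  by exists (Mr + Mi) => y; apply: le_trans (le_normc_ReIm _) _; apply: lerD; [exact: hr|exact: hi].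
Qed.

(** The condition from which [measure_conv] chooses, taken as a relation. Linearity of the relation
    in each argument serves twice: it reduces existence to positive measures, and with uniqueness it
    makes [measure_conv] bilinear. *)
Definition is_conv mu nu lambda := forall g, C0 g ->
  cintegral lambda g = cintegral nu (fun y => cintegral mu (fun x => g (mul x y))).

Lemma is_conv_linl (a : R[i]) mu1 mu2 nu l1 l2 : is_conv mu1 nu l1 -> is_conv mu2 nu l2 ->
  is_conv (a *: mu1 + mu2) nu (a *: l1 + l2).
Proof.
move=> h1 h2 g Cg; have cg := C0_ccontinuous Cg.
rewrite cintegral_linl; last exact: ccontinuous_bounded.
rewrite h1// h2// -(cintegral_linr hS); last 2 first.
- by apply: ccontinuous_bounded; exact: ccontinuous_cintegral.
- by apply: ccontinuous_bounded; exact: ccontinuous_cintegral.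
congr cintegral; apply/funext => y; rewrite cintegral_linl//.
by apply: ccontinuous_bounded; exact: ccontinuous_translate.
Qed.

Lemma is_conv_linr (a : R[i]) mu nu1 nu2 l1 l2 : is_conv mu nu1 l1 -> is_conv mu nu2 l2 ->
  is_conv mu (a *: nu1 + nu2) (a *: l1 + l2).
Proof.
move=> h1 h2 g Cg; have cg := C0_ccontinuous Cg.
rewrite cintegral_linl; last exact: ccontinuous_bounded.
rewrite h1// h2// -cintegral_linl//.
by apply: ccontinuous_bounded; exact: ccontinuous_cintegral.
Qed.

Lemma is_conv_cm p q (rp : regular_measure p) (rq : regular_measure q) :
  exists (r : {finite_measure set (borel S) -> \bar R}) (rr : regular_measure r),
    fine (r setT) = fine (p setT) * fine (q setT) /\
    is_conv (cm hS rp) (cm hS rq) (cm hS rr).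
Proof.
have [r [rr rT rint]] := positive_convolution hS lcS sc rp rq.
exists r, rr; split => // g Cg; have cg := C0_ccontinuous Cg.
have [gr gi [M gM]] := cg.
rewrite !cintegral_cmE; last 2 first.
- by apply: ccontinuous_bounded; exact: ccontinuous_cintegral.
- exact: ccontinuous_bounded.
rewrite rint//; last by exists M => x; exact: le_trans (le_normc_Re _) (gM x).
rewrite rint//; last by exists M => x; exact: le_trans (le_normc_Im _) (gM x).
congr Complex; apply: eq_Rintegral => y _; rewrite cintegral_cmE//;
  by apply: ccontinuous_bounded; exact: ccontinuous_translate.
Qed.

Lemma is_conv_exists mu nu : exists lambda, is_conv mu nu lambda.
Proof.
elim/(@cmeasure_ind R S hS) : mu => [a mu1 mu2 [l1 h1] [l2 h2]|p rp].
  by exists (a *: l1 + l2); exact: is_conv_linl.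
elim/(@cmeasure_ind R S hS) : nu => [a nu1 nu2 [l1 h1] [l2 h2]|q rq].
  by exists (a *: l1 + l2); exact: is_conv_linr.
by have [r [rr [_ h]]] := is_conv_cm rp rq; exists (cm hS rr).
Qed.

Lemma measure_convP mu nu : is_conv mu nu (measure_conv mul mu nu).
Proof.
have [l h] := is_conv_exists mu nu.
rewrite /measure_conv; case: xgetP => [x _ xP //|nP].
by have := nP l; case.
Qed.

Lemma measure_convE mu nu lambda : is_conv mu nu lambda -> measure_conv mul mu nu = lambda.
Proof.
by move=> h; apply: cintegral_inj => // g Cg; rewrite h// measure_convP.
Qed.

Lemma measure_conv_linl (a : R[i]) mu1 mu2 nu : measure_conv mul (a *: mu1 + mu2) nu =
  a *: measure_conv mul mu1 nu + measure_conv mul mu2 nu.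
Proof. by apply: measure_convE; apply: is_conv_linl; exact: measure_convP. Qed.

Lemma measure_conv_linr (a : R[i]) mu nu1 nu2 : measure_conv mul mu (a *: nu1 + nu2) =
  a *: measure_conv mul mu nu1 + measure_conv mul mu nu2.
Proof. by apply: measure_convE; apply: is_conv_linr; exact: measure_convP. Qed.

Lemma measure_conv_positive mu nu : positive_measure mu -> positive_measure nu ->
  positive_measure (measure_conv mul mu nu) /\
  tvnorm (measure_conv mul mu nu) = tvnorm mu * tvnorm nu.
Proof.
move=> /(positive_cmP hS)[p [rp ->]] /(positive_cmP hS)[q [rq ->]].
have [r [rr [rT h]]] := is_conv_cm rp rq.
by rewrite (measure_convE h) !tvnorm_cm; split => //; exact: positive_cm.
Qed.

Lemma measure_conv0l nu : measure_conv mul 0 nu = 0.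
Proof.
have := measure_conv_linl (-1) 0 0 nu.
by rewrite scaler0 addr0 scaleN1r addNr.
Qed.

Lemma measure_conv0r mu : measure_conv mul mu 0 = 0.
Proof.
have := measure_conv_linr (-1) mu 0 0.
by rewrite scaler0 addr0 scaleN1r addNr.
Qed.

(** The factor 4 counts the positive parts of [nu], each of norm at most that of [nu]. It is not
    sharp, but it suffices to see that f mu is again a bounded functional. *)
Lemma tvnorm_measure_conv mu nu : positive_measure mu ->
  tvnorm (measure_conv mul mu nu) <= 4 * tvnorm mu * tvnorm nu.
Proof.
move=> pmu.
have [q1 [q2 [q3 [q4 [[p1 b1] [p2 b2] [p3 b3] [p4 b4] nuE]]]]] := cmeasure_decomp hS nu.
have h (q : cmeasure R S) : positive_measure q -> tvnorm q <= tvnorm nu ->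
    tvnorm (measure_conv mul mu q) <= tvnorm mu * tvnorm nu.
  move=> pq qb; have [_ ->] := measure_conv_positive pmu pq.
  by rewrite ler_wpM2l// tvnorm_ge0.
have hB (q q' : cmeasure R S) : measure_conv mul mu (q - q') =
    measure_conv mul mu q - measure_conv mul mu q'.
  by rewrite addrC -scaleN1r measure_conv_linr scaleN1r addrC.
rewrite [in leLHS]nuE addrC measure_conv_linr !hB.
apply: le_trans (tvnorm_lin _ _ _) _.
have -> : normc ('i%C : R[i]) = 1 by rewrite normc_imag normr1.
rewrite mul1r.
have -> : 4 * tvnorm mu * tvnorm nu =
    (tvnorm mu * tvnorm nu + tvnorm mu * tvnorm nu) +
    (tvnorm mu * tvnorm nu + tvnorm mu * tvnorm nu) by ring.
by apply: lerD; apply: le_trans (tvnormB _ _) _; apply: lerD; exact: h.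
Qed.

Lemma cintegral_point_mass x g : ccontinuous g -> cintegral (point_mass R hS x) g = g x.
Proof.
move=> cg; have [br bi] := ccontinuous_bounded cg.
pose d : {finite_measure set (borel S) -> \bar R} := \d_(x : borel S).
have dE A : is_borel A -> re (point_mass R hS x) A = d A.
  move=> bA; rewrite reE /= /dirac_fun /d /= diracE; case: asboolP => [[_ Ax]|nA].
    by rewrite mem_set.
  by rewrite memNset// => Ax; apply: nA.
have rE h : bounded_measurable (h : borel S -> R) ->
    charge_integral (re (point_mass R hS x)) h = h x.
  move=> bh; rewrite (charge_integral_measure bh dE) /Rintegral integral_dirac//.
    by rewrite diracT mul1e.
  by apply/measurable_EFinP; case: bh.
have iE h : bounded_measurable (h : borel S -> R) ->
    charge_integral (im (point_mass R hS x)) h = 0.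
  move=> bh; rewrite (@charge_integral_measure _ _ _ (finite_measure_of (@mzero_finite R S)))//.
    by rewrite /Rintegral integral_measure_zero.
  by move=> A bA; rewrite imE /= /dirac_fun; case: ifP.
rewrite /cintegral -!/(re _) -!/(im _) !rE// !iE// subr0 addr0.
by case: (g x).
Qed.

Lemma measure_conv_unit e nu : left_id e mul -> measure_conv mul (point_mass R hS e) nu = nu.
Proof.
move=> mul1; apply: measure_convE => g /C0_ccontinuous cg.
congr cintegral; apply/funext => y; rewrite cintegral_point_mass ?mul1//.
exact: ccontinuous_translate.
Qed.

Lemma M0_point_mass x : @M0 R S (point_mass R hS x).
Proof.
split => [A bA|]; last by rewrite /= /dirac_fun asboolT//; split => //; exact: measurableT.
by rewrite /= /dirac_fun; case: ifP.
Qed.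

End measure_conv.

(** * Hahn-Banach separation *)

Section hahn_banach.
Context {R : realType} {V : lmodType R} (p : V -> R).
Hypotheses (pD : forall u v, p (u + v) <= p u + p v)
  (pZ : forall (a : R) v, 0 < a -> p (a *: v) = a * p v).

(** Partial linear functionals below [p], encoded by their graphs so that Zorn's lemma applies to
    unions. Single-valuedness need not be required: if (v, r) and (v, s) lie in G, so do (0, r - s)
    and (0, s - r), and p 0 = 0 forces r = s. *)
Let dominated (G : set (V * R)) := (forall (a : R) x y, G x -> G y ->
  G (a *: x.1 + y.1, a * x.2 + y.2)) /\ forall x, G x -> x.2 <= p x.1.

Let p0 : p 0 = 0.
Proof.
have h2 : (0 : R) < 2 by [].
have := pZ 0 h2; rewrite scaler0 => h.
by lra.
Qed.

(** The value c at [v0] must lie above every r - p (y - v0) and below every p (y + v0) - r, for (y,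
    r) in G. Subadditivity makes these bounds compatible, so the supremum of the lower ones will do;
    homogeneity then covers all multiples of [v0]. *)
Let dominated_extend (G : set (V * R)) (v0 : V) : dominated G -> G (0, 0) ->
  exists c, dominated [set x | exists y t, G y /\ x = (y.1 + t *: v0, y.2 + t * c)].
Proof.
move=> [lG dG] G0.
pose E := [set r | exists2 y, G y & r = y.2 - p (y.1 - v0)].
have Eub y : G y -> ubound E (p (y.1 + v0) - y.2).
  move=> Gy _ [x Gx ->].
  have := dG _ (lG 1 _ _ Gx Gy); rewrite /= scale1r mul1r.
  have := pD (x.1 - v0) (y.1 + v0).
  by rewrite addrACA addNr addr0; lra.
have hE : has_sup E.
  split; first by exists (0 - p (0 - v0)); exists (0, 0).
  by exists (p (0 + v0) - 0); exact: (Eub _ G0).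
exists (sup E); split.
  move=> a _ _ [x [t [Gx ->]]] [y [s [Gy ->]]] /=.
  exists (a *: x.1 + y.1, a * x.2 + y.2), (a * t + s); split; first exact: lG.
  congr pair => /=; last by ring.
  by rewrite scalerDr scalerDl scalerA addrACA.
move=> _ [y [t [Gy ->]]] /=.
have scG (a : R) x : G x -> G (a *: x.1, a * x.2).
  by move=> Gx; have := lG a _ _ Gx G0; rewrite /= !addr0.
have [t0|t0|->] := ltgtP t 0; last by rewrite scale0r mul0r !addr0; exact: dG.
- have s0 : 0 < - t^-1 by rewrite oppr_gt0 invr_lt0.
  have h : (- t^-1) * y.2 - p ((- t^-1) *: y.1 - v0) <= sup E.
    by apply: ub_le_sup; [case: hE|exists (- t^-1 *: y.1, - t^-1 * y.2) => //; exact: scG].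
  have E1 : - t^-1 *: y.1 - v0 = - t^-1 *: (y.1 + t *: v0).
    by rewrite scalerDr scalerA mulNr mulVf ?lt_eqF// scaleN1r.
  rewrite E1 pZ// -mulrBr in h.
  have : t * sup E <= t * (- t^-1 * (y.2 - p (y.1 + t *: v0))) by rewrite ler_nM2l.
  by rewrite mulrA mulrN mulfV ?lt_eqF// mulN1r; lra.
- have s0 : 0 < t^-1 by rewrite invr_gt0.
  have h : sup E <= p (t^-1 *: y.1 + v0) - t^-1 * y.2.
    by apply: ge_sup; [case: hE|exact: (Eub _ (scG t^-1 _ Gy))].
  have E1 : t^-1 *: y.1 + v0 = t^-1 *: (y.1 + t *: v0).
    by rewrite scalerDr scalerA mulVf ?gt_eqF// scale1r.
  rewrite E1 pZ// -mulrBr in h.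
  have : t * sup E <= t * (t^-1 * (p (y.1 + t *: v0) - y.2)) by rewrite ler_pM2l.
  by rewrite mulrA mulfV ?gt_eqF// mul1r; lra.
Qed.

Theorem hahn_banach : exists F : V -> R,
  (forall (a : R) u v, F (a *: u + v) = a * F u + F v) /\ forall v, F v <= p v.
Proof.
have [|G [domG maxG]] := @Zorn_bigcup _ dominated.
  move=> C Cdom Ctot; split; last first.
    by move=> x [G CG Gx]; have [_] := Cdom _ CG; exact.
  move=> a x y [G1 C1 G1x] [G2 C2 G2y].
  have [G12|G21] := Ctot _ _ C1 C2.
    by exists G2 => //; have [h _] := Cdom _ C2; apply: h => //; exact: G12.
  by exists G1 => //; have [h _] := Cdom _ C1; apply: h => //; exact: G21.
have [lG dG] := domG.
have G0 : G (0, 0).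
  have [[x Gx]|nG] := pselect (G !=set0).
    have := lG (-1) _ _ Gx Gx; rewrite scaleN1r mulN1r !addNr; exact.
  (* The empty graph satisfies [dominated] vacuously, but it is not maximal. *)
  exfalso; apply: (maxG [set (0, 0)]).
    split => [x Gx|]; first by exfalso; apply: nG; exists x.
    by move=> /(_ (0, 0) erefl) G0; apply: nG; exists (0, 0).
  split => [a _ _ -> ->|_ ->] /=; first by rewrite scaler0 mulr0 !addr0.
  by rewrite p0.
have Gtot v : exists r, G (v, r).
  (* The extension contains (v, c); by maximality it is not strictly larger than [G]. *)
  have [c domG'] := dominated_extend v domG G0.
  apply: contrapT => nG; apply: maxG domG'; split.
    by move=> [x r] Gx; exists (x, r), 0; split => //; rewrite scale0r mul0r !addr0.
  move=> /(_ (v, c)) h; apply: nG; exists c; apply: h.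
  by exists (0, 0), 1; split => //=; rewrite scale1r mul1r !add0r.
have Gfun v r s : G (v, r) -> G (v, s) -> r = s.
  move=> Gr Gs; have h1 := lG (-1) _ _ Gr Gs; have h2 := lG (-1) _ _ Gs Gr.
  have := dG _ h1; have := dG _ h2.
  by rewrite /= scaleN1r addNr p0; lra.
have /choice[F FG] := Gtot; exists F; split.
  move=> a u v; apply: (Gfun (a *: u + v)) => //.
  exact: (lG a _ _ (FG u) (FG v)).
by move=> v; exact: (dG _ (FG v)).
Qed.

End hahn_banach.

(** * Invariant means *)

Section finite_sup.
Context {R : realType} {n : nat} (t : 'I_n -> R).

Lemma le_sup_ord i : t i <= sup [set t j | j in [set: 'I_n]].
Proof.
apply: ub_le_sup; last by exists i.
exists (\sum_j `|t j|) => _ [j _ <-]; rewrite (bigD1 j)//=.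
by apply: le_trans (ler_norm _) _; rewrite lerDl sumr_ge0.
Qed.

Lemma sup_ord_le (x : R) : (0 < n)%N -> (forall i, t i <= x) ->
  sup [set t j | j in [set: 'I_n]] <= x.
Proof.
move=> n0 tx; apply: ge_sup; first by exists (t (Ordinal n0)), (Ordinal n0).
by move=> _ [j _ <-].
Qed.

End finite_sup.

Definition almost_invariant {R : realType} {S : ptopologicalType} (mul : S -> S -> S) :=
  forall (s : seq (cmeasure R S)) (e : R), (forall th, th \in s -> M0 th) -> 0 < e ->
  exists2 la, M0 la & forall th, th \in s -> tvnorm (measure_conv mul th la - la) < e.
Arguments almost_invariant R {S} mul.

Section invariant_mean.
Context {R : realType} {S : ptopologicalType} (mul : S -> S -> S).
Hypotheses (hS : hausdorff_space S) (lcS : locally_compact [set: S]).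
Hypothesis sc : separately_continuous mul.
Implicit Types (mu nu la th : cmeasure R S) (f g : cmeasure R S -> R[i]).

Lemma almost_invariant_of_inf (e : S) : left_id e mul ->
  (forall (n : nat) (mus : 'I_n -> cmeasure R S), (0 < n)%N ->
      inf [set sup [set tvnorm (measure_conv mul (mus i) mu) | i in [set: 'I_n]]
             | mu in @M0 R S]
      <= sup [set normc (mus i setT) | i in [set: 'I_n]]) ->
  almost_invariant R mul.
Proof.
move=> mul1 H s eps sM0 e0.
have [s0|s0] := posnP (size s).
  exists (point_mass R hS e); first exact: M0_point_mass.
  by move: s0 => /eqP/nilP -> th.
pose d := point_mass R hS e; pose mus (i : 'I_(size s)) := nth 0 s i - d.
have := H _ mus s0.
have -> : sup [set normc (mus i setT) | i in [set: 'I_(size s)]] = 0.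
  have z i : normc (mus i setT) = 0.
    rewrite /mus cmeasureDE cmeasureNE (proj2 (M0_point_mass hS e)).
    by rewrite (proj2 (sM0 _ (mem_nth 0 (ltn_ord i)))) subrr ComplexField.Normc.normc0.
  apply/eqP; rewrite eq_le; apply/andP; split.
    by apply: sup_ord_le => // i; rewrite z.
  by rewrite -(z (Ordinal s0)); exact: (le_sup_ord (fun i => normc (mus i setT))).
set E := [set _ | _ in _] => Einf.
have hE : has_inf E.
  split.
    by eexists; exists d; [exact: M0_point_mass|reflexivity].
  exists 0 => _ [la _ <-]; apply: le_trans (le_sup_ord _ (Ordinal s0)).
  exact: tvnorm_ge0.
have [_ [la M0la <-]] := inf_adherent e0 hE.
move=> lt_e; exists la => // th ths.
have ith : (index th s < size s)%N by rewrite index_mem.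
have := le_sup_ord (fun i => tvnorm (measure_conv mul (mus i) la)) (Ordinal ith).
rewrite {1}/mus /= nth_index// addrC -scaleN1r measure_conv_linl//.
rewrite measure_conv_unit// scaleN1r addrC => h.
apply: le_lt_trans h _; apply: lt_le_trans lt_e _.
by rewrite gerDr.
Qed.

Lemma Mdual_bound f : Mdual f -> exists2 C : R, 0 <= C &
  forall mu, normc (f mu) <= C * tvnorm mu.
Proof.
move=> [_ [C fC]]; exists `|C| => // mu; apply: le_trans (fC mu) _.
by rewrite ler_wpM2r ?tvnorm_ge0// ler_norm.
Qed.

Lemma MdualB f mu nu : Mdual f -> f (mu - nu) = f mu - f nu.
Proof.
by move=> [lf _]; rewrite addrC -scaleN1r lf mulN1r addrC.
Qed.

Lemma Mdual_norm_ge f mu : Mdual f -> tvnorm mu <= 1 -> normc (f mu) <= Mdual_norm f.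
Proof.
move=> df mu1; have [C C0 fC] := Mdual_bound df.
apply: ub_le_sup; last by exists mu.
exists C => _ [nu /= nu1 <-]; apply: le_trans (fC nu) _.
by rewrite ler_piMr.
Qed.

Lemma invariant_mean_of_almost : almost_invariant R mul ->
  exists M : (cmeasure R S -> R[i]) -> R[i], is_mean M /\ topologically_left_invariant mul M.
Proof.
move=> ai.
(* The sets [B x] are nonempty by almost invariance, and concatenating lists and taking the smaller
   tolerance refines two of them: they generate a proper filter. *)
pose D := [set x : seq (cmeasure R S) * R | (forall th, th \in x.1 -> M0 th) /\ 0 < x.2].
pose B (x : seq (cmeasure R S) * R) := [set la | M0 la /\
  forall th, th \in x.1 -> tvnorm (measure_conv mul th la - la) < x.2].
have FF : ProperFilter (filter_from D B).
  apply: filter_from_proper; last first.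
    by move=> [s e] [/= sM e0]; have [la l0 lP] := ai s e sM e0; exists la.
  apply: filter_from_filter; first by exists ([::], 1); split.
  move=> [s e] [s' e'] [/= sM e0] [/= sM' e0'].
  exists (s ++ s', Num.min e e').
    split=> /=; last by rewrite lt_min e0.
    by move=> th; rewrite mem_cat => /orP[/sM|/sM'].
  move=> la [M0la] /= h; split; split => //= th ths.
    have := h th; rewrite mem_cat ths => /(_ isT) /lt_le_trans; apply.
    by rewrite ge_min lexx.
  have := h th; rewrite mem_cat ths orbT => /(_ isT) /lt_le_trans; apply.
  by rewrite ge_min lexx orbT.
have [u [uu Bu]] := ultraFilterLemma FF.
have uM0 : u (@M0 R S).
  by apply: Bu; exists ([::], 1); [split|move=> la []].
have uai th e : M0 th -> 0 < e -> u [set la | tvnorm (measure_conv mul th la - la) < e].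
  move=> th0 e0; apply: Bu; exists ([:: th], e).
    by split=> //= th'; rewrite inE => /eqP ->.
  by move=> la [_ /(_ th)]; rewrite /= mem_head; exact.
(* A bounded real function converges along an ultrafilter because segments are compact. *)
have ucvg (h : cmeasure R S -> R) : (exists C, forall la, M0 la -> `|h la| <= C) ->
    h @ u --> lim (h @ u).
  move=> [C hC]; have cK : compact `[- C, C]%classic by exact: segment_compact.
  have [|l _ hl] := ultra_compact_cvg (f := h) uu cK; last exact: cvgP hl.
  by apply: filterS uM0 => la /hC; rewrite /= in_itv /= ler_norml.
pose M (f : cmeasure R S -> R[i]) : R[i] := Complex (lim ((fun la => Re (f la)) @ u))
  (lim ((fun la => Im (f la)) @ u)).
have Mdual_M0 f : Mdual f -> forall la, M0 la -> normc (f la) <= Mdual_norm f.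
  by move=> df la M0la; apply: Mdual_norm_ge => //; rewrite (M0_tvnorm hS M0la).
have Mre f : Mdual f -> (fun la => Re (f la)) @ u --> Re (M f).
  move=> df; apply: ucvg; exists (Mdual_norm f) => la M0la.
  exact: le_trans (le_normc_Re _) (Mdual_M0 f df la M0la).
have Mim f : Mdual f -> (fun la => Im (f la)) @ u --> Im (M f).
  move=> df; apply: ucvg; exists (Mdual_norm f) => la M0la.
  exact: le_trans (le_normc_Im _) (Mdual_M0 f df la M0la).
have limE (h : cmeasure R S -> R) l : h @ u --> l -> lim (h @ u) = l.
  by move=> hl; exact: cvg_lim.
exists M; split; first split.
- split.
    move=> a f g df dg.
    have -> : a * M f + M g =
        Complex (Re a * Re (M f) - Im a * Im (M f) + Re (M g))
                (Re a * Im (M f) + Im a * Re (M f) + Im (M g)).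
      by case: (a) (M f) (M g) => [? ?] [? ?] [? ?].
    rewrite {1}/M; congr Complex; apply: limE.
      rewrite (_ : (fun la => _) =
        (fun la => Re a * Re (f la) - Im a * Im (f la) + Re (g la))); last first.
        by apply/funext => la; case: (a) (f la) (g la) => [? ?] [? ?] [? ?].
      apply: cvgD; last exact: Mre.
      by apply: cvgB; apply: cvgM; [exact: cvg_cst|exact: Mre|exact: cvg_cst|exact: Mim].
    rewrite (_ : (fun la => _) =
      (fun la => Re a * Im (f la) + Im a * Re (f la) + Im (g la))); last first.
      by apply/funext => la; case: (a) (f la) (g la) => [? ?] [? ?] [? ?].
    apply: cvgD; last exact: Mim.
    by apply: cvgD; apply: cvgM; [exact: cvg_cst|exact: Mim|exact: cvg_cst|exact: Mre].
  (* The real and the imaginary part are each bounded by [Mdual_norm f]; boundedness is all that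
     [Mbidual] requires. *)
  exists 2 => f df.
  apply: le_trans (le_normc_ReIm _) _; rewrite mulr_natl mulr2n; apply: lerD.
    apply: (closed_cvg (fun r : R => r <= Mdual_norm f) (@closed_le _ _) _ _ (cvg_norm (Mre f df))).
    by apply: filterS uM0 => la /(Mdual_M0 f df); exact: le_trans (le_normc_Re _).
  apply: (closed_cvg (fun r : R => r <= Mdual_norm f) (@closed_le _ _) _ _ (cvg_norm (Mim f df))).
  by apply: filterS uM0 => la /(Mdual_M0 f df); exact: le_trans (le_normc_Im _).
- move=> f df f0.
  have h la : M0 la -> Im (f la) = 0 /\ 0 <= Re (f la).
    by move=> [/f0]; rewrite lecE => /andP[/eqP].
  rewrite lecE; apply/andP; split; last first.
    apply: (closed_cvg (fun r : R => 0 <= r) (@closed_ge _ _) _ _ (Mre f df)).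
    by apply: filterS uM0 => la /h[].
  apply/eqP; apply: limE; apply: cvg_near_cst.
  by apply: filterS uM0 => la /h[].
- rewrite /M; have -> : (1 : R[i]) = Complex 1 0 by [].
  by congr Complex; apply: limE; apply: cvg_near_cst;
    apply: filterS uM0 => la [_]; rewrite /one_functional => ->.
- move=> th f th0 df; have [C C0 fC] := Mdual_bound df.
  (* A bounded functional turns the norm smallness of th * la - la into equality of the limits of f
     (th * la) and f la along [u]. *)
  have key e : 0 < e -> u [set la | normc (f (measure_conv mul th la) - f la) <= e].
    move=> e0; have e1 : 0 < e / (C + 1) by rewrite divr_gt0//; lra.
    apply: filterS (uai th _ th0 e1) => la /= hla.
    rewrite -MdualB//; apply: le_trans (fC _) _.
    apply: (@le_trans _ _ (C * (e / (C + 1)))); first by rewrite ler_wpM2l// ltW.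
    rewrite mulrCA; apply: ler_piMr; first exact: ltW.
    by rewrite ler_pdivrMr; lra.
  have ReB (x y : R[i]) : Re (x - y) = Re x - Re y by case: x y => [? ?] [? ?].
  have ImB (x y : R[i]) : Im (x - y) = Im x - Im y by case: x y => [? ?] [? ?].
  rewrite /M; congr Complex; apply: limE.
    apply: cvg_sub0 (Mre f df).
    apply/cvgrPdist_le => e e0; apply: filterS (key e e0) => la; apply: le_trans.
    by rewrite sub0r normrN; apply: le_trans (le_normc_Re _); rewrite ReB.
  apply: cvg_sub0 (Mim f df).
  apply/cvgrPdist_le => e e0; apply: filterS (key e e0) => la; apply: le_trans.
  by rewrite sub0r normrN; apply: le_trans (le_normc_Im _); rewrite ImB.
Qed.

End invariant_mean.

(** * From an invariant mean to almost invariant measures *)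

Section restrict_scalars.
Context {R : realType} (V : lmodType R[i]).

(** A separate name for the carrier, so that it can carry the real scalar multiplication that
    [hahn_banach] asks for. *)
Definition real_module : Type := V.
HB.instance Definition _ := GRing.Zmodule.on real_module.

Let scale (a : R) (v : real_module) : real_module := (a%:C)%C *: (v : V).

Let scaleA a b v : scale a (scale b v) = scale (a * b) v.
Proof. by rewrite /scale scalerA -rmorphM. Qed.
Let scale1 v : scale 1 v = v. Proof. exact: scale1r. Qed.
Let scaleDr : right_distributive scale +%R.
Proof. by move=> a u v; exact: scalerDr. Qed.
Let scaleDl v : {morph scale^~ v : a b / a + b}.
Proof. by move=> a b; rewrite /scale rmorphD scalerDl. Qed.

HB.instance Definition _ := GRing.Zmodule_isLmodule.Build R real_module
  scaleA scale1 scaleDr scaleDl.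

End restrict_scalars.

Section real_part.
Context {R : realType} {S : ptopologicalType}.
Hypothesis hS : hausdorff_space S.
Implicit Types (mu nu la th : cmeasure R S).

Lemma cmeasure_Re_exists mu : exists2 rho : cmeasure R S,
  (forall A, is_borel A -> rho A = Complex (Re (mu A)) 0) & tvnorm rho <= 2 * tvnorm mu.
Proof.
have [q1 [q2 [q3 [q4 [[p1 b1] [p2 b2] [p3 _] [p4 _] muE]]]]] := cmeasure_decomp hS mu.
exists (q1 - q2); last by apply: le_trans (tvnormB _ _) _; lra.
move=> A bA; rewrite [in RHS]muE !cmeasureDE cmeasureZE !cmeasureDE !cmeasureNE.
have := positive_real A p1; have := positive_real A p2.
have := positive_real A p3; have := positive_real A p4.
case: (q1 A) (q2 A) (q3 A) (q4 A) => [? ?] [? ?] [? ?] [? ?] /= -> -> -> ->.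
by apply/eqP; rewrite eq_complex /=; apply/andP; split; apply/eqP; ring.
Qed.

Definition cmeasure_Re mu : cmeasure R S := projT1 (cid2 (cmeasure_Re_exists mu)).

Lemma cmeasure_ReE mu A : is_borel A -> cmeasure_Re mu A = Complex (Re (mu A)) 0.
Proof. by move=> bA; rewrite /cmeasure_Re; case: cid2 => rho /= -> . Qed.

Lemma tvnorm_cmeasure_Re mu : tvnorm (cmeasure_Re mu) <= 2 * tvnorm mu.
Proof. by rewrite /cmeasure_Re; case: cid2. Qed.

Definition cmeasure_Im mu := cmeasure_Re (- 'i%C *: mu).

Lemma cmeasure_ImE mu A : is_borel A -> cmeasure_Im mu A = Complex (Im (mu A)) 0.
Proof.
move=> bA; rewrite cmeasure_ReE// cmeasureZE; case: (mu A) => a b /=.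
by apply/eqP; rewrite eq_complex /=; apply/andP; split; apply/eqP; ring.
Qed.

Lemma cmeasure_Re_lin (a : R[i]) mu nu : cmeasure_Re (a *: mu + nu) =
  ((Re a)%:C)%C *: cmeasure_Re mu + (((- Im a)%:C)%C *: cmeasure_Im mu + cmeasure_Re nu).
Proof.
apply: cmeasure_ext => A bA.
rewrite !cmeasureDE !cmeasureZE cmeasure_ImE// !cmeasure_ReE// cmeasure_linE.
case: (a) (mu A) (nu A) => [? ?] [? ?] [? ?].
by apply/eqP; rewrite eq_complex /=; apply/andP; split; apply/eqP; ring.
Qed.

Lemma cmeasure_Im_lin (a : R[i]) mu nu : cmeasure_Im (a *: mu + nu) =
  ((Re a)%:C)%C *: cmeasure_Im mu + (((Im a)%:C)%C *: cmeasure_Re mu + cmeasure_Im nu).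
Proof.
apply: cmeasure_ext => A bA.
rewrite !cmeasureDE !cmeasureZE !cmeasure_ImE// cmeasure_ReE// cmeasure_linE.
case: (a) (mu A) (nu A) => [? ?] [? ?] [? ?].
by apply/eqP; rewrite eq_complex /=; apply/andP; split; apply/eqP; ring.
Qed.

Lemma cmeasure_Re_positive mu : positive_measure mu -> cmeasure_Re mu = mu.
Proof.
move=> pmu; apply: cmeasure_ext => A bA; rewrite cmeasure_ReE//.
by have := positive_real A pmu; case: (mu A) => a b /= ->.
Qed.

Lemma cmeasure_Im_positive mu : positive_measure mu -> cmeasure_Im mu = 0.
Proof.
move=> pmu; apply: cmeasure_ext => A bA; rewrite cmeasure_ImE//.
by rewrite (positive_real A pmu).
Qed.

(** Complexification: [F] is kept on real measures and extended by f mu = F (Re mu) + i F (Im mu).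
    Both parts of mu have norm at most twice that of mu, which gives the bound 4C. *)
Lemma Mdual_of_real (F : cmeasure R S -> R) (C : R) :
  (forall (a : R) mu nu, F ((a%:C)%C *: mu + nu) = a * F mu + F nu) ->
  (forall mu, `|F mu| <= C * tvnorm mu) -> 0 <= C ->
  exists2 f, Mdual f & forall mu, positive_measure mu -> f mu = Complex (F mu) 0.
Proof.
move=> Flin FC C0.
have F0 : F 0 = 0 by have := Flin (-1) 0 0; rewrite scaler0 addr0; lra.
exists (fun mu => Complex (F (cmeasure_Re mu)) (F (cmeasure_Im mu))); last first.
  by move=> mu pmu; rewrite cmeasure_Re_positive// cmeasure_Im_positive// F0.
split.
  move=> a mu nu; rewrite cmeasure_Re_lin cmeasure_Im_lin !Flin.
  case: (a) => a1 a2; apply/eqP; rewrite eq_complex /=.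
  by apply/andP; split; apply/eqP; ring.
exists (C * 4) => mu; apply: le_trans (le_normc_ReIm _) _ => /=.
have h1 := FC (cmeasure_Re mu); have h2 := FC (cmeasure_Im mu).
have t1 := ler_wpM2l C0 (tvnorm_cmeasure_Re mu).
have := tvnorm_cmeasure_Re (- 'i%C *: mu); rewrite -/(cmeasure_Im mu) => t2.
have t3 : tvnorm (- 'i%C *: mu) <= tvnorm mu.
  apply: le_trans (tvnormZ _ _) _.
  have -> : normc (- 'i%C : R[i]) = 1 by rewrite /= oppr0 expr0n /= add0r sqrrN expr1n sqrtr1.
  by rewrite mul1r.
have t4 : C * tvnorm (cmeasure_Im mu) <= C * (2 * tvnorm mu).
  by apply: ler_wpM2l => //; lra.
lra.
Qed.

End real_part.

Section almost_invariant_of_mean.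
Context {R : realType} {S : ptopologicalType} (mul : S -> S -> S).
Hypotheses (hS : hausdorff_space S) (lcS : locally_compact [set: S]).
Hypothesis sc : separately_continuous mul.
Implicit Types (mu nu la th pi : cmeasure R S) (f g : cmeasure R S -> R[i]).

Lemma positive_measure0 : positive_measure (0 : cmeasure R S).
Proof. by move=> A _; rewrite cmeasure0E. Qed.

Lemma positive_measureZ (a : R) mu : 0 <= a -> positive_measure mu ->
  positive_measure ((a%:C)%C *: mu).
Proof.
move=> a0 pmu A bA; rewrite cmeasureZE; apply: mulr_ge0; last exact: pmu.
by rewrite lecE /= eqxx.
Qed.

Lemma tvnorm_positiveD mu nu : positive_measure mu -> positive_measure nu ->
  tvnorm (mu + nu) = tvnorm mu + tvnorm nu.
Proof.
move=> pmu pnu; have := positive_tvnorm hS (positiveD pmu pnu).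
by rewrite cmeasureDE (positive_tvnorm hS pmu) (positive_tvnorm hS pnu) => -[].
Qed.

Lemma tvnorm_positiveZ (a : R) mu : 0 <= a -> positive_measure mu ->
  tvnorm ((a%:C)%C *: mu) = a * tvnorm mu.
Proof.
move=> a0 pmu; have := positive_tvnorm hS (positive_measureZ a0 pmu).
by rewrite cmeasureZE (positive_tvnorm hS pmu) => -[]; lra.
Qed.

Lemma M0_normalize mu : positive_measure mu -> 0 < tvnorm mu ->
  M0 ((((tvnorm mu)^-1)%:C)%C *: mu).
Proof.
move=> pmu m0; have i0 : 0 <= (tvnorm mu)^-1 by rewrite invr_ge0 ltW.
split; first exact: positive_measureZ.
rewrite (positive_tvnorm hS (positive_measureZ i0 pmu)) tvnorm_positiveZ//.
by rewrite mulVf// gt_eqF.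
Qed.

Lemma Mdual_lin (a : R[i]) f g : Mdual f -> Mdual g -> Mdual (fun mu => a * f mu + g mu).
Proof.
move=> df dg; have [C C0 fC] := Mdual_bound df; have [D D0 gD] := Mdual_bound dg.
split.
  by move=> b mu nu; rewrite (proj1 df) (proj1 dg); ring.
exists (normc a * C + D) => mu; apply: le_trans (le_normcD _ _) _.
rewrite ComplexField.Normc.normcM mulrDl -mulrA; apply: lerD => //.
by apply: ler_wpM2l; [exact: normc_ge0|exact: fC].
Qed.

Lemma Mdual0 : Mdual (fun _ : cmeasure R S => 0 : R[i]).
Proof.
split; first by move=> a mu nu; rewrite mulr0 addr0.
by exists 0 => mu; rewrite ComplexField.Normc.normc0 mul0r.
Qed.

Lemma Mdual_one : Mdual (@one_functional R S).
Proof.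
split; first by move=> a mu nu.
by exists 1 => mu; rewrite mul1r; exact: le_normc_tvnorm.
Qed.

Lemma Mdual_act f th : M0 th -> Mdual f -> Mdual (functional_act mul f th).
Proof.
move=> [pth _] df; have [C C0 fC] := Mdual_bound df; split.
  by move=> a mu nu; rewrite /functional_act measure_conv_linr// (proj1 df).
exists (C * (4 * tvnorm th)) => mu; apply: le_trans (fC _) _.
by rewrite -mulrA; apply: ler_wpM2l => //; exact: tvnorm_measure_conv.
Qed.

Section separation.
Variables (n : nat) (th : 'I_n -> cmeasure R S) (e : R).
Hypotheses (e0 : 0 < e) (thM0 : forall i, M0 (th i)).
Hypothesis far : forall la, M0 la ->
  exists i, e <= tvnorm (measure_conv mul (th i) la - la).

Let V := real_module ('I_n -> cmeasure R S).
Let T (pi : cmeasure R S) : V := fun i => measure_conv mul (th i) pi - pi.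
Let N (v : V) : R := \sum_i tvnorm (v i).

Let vDE (u v : V) i : (u + v) i = u i + v i. Proof. by []. Qed.
Let vZE (a : R) (v : V) i : (a *: v) i = (a%:C)%C *: v i. Proof. by []. Qed.

Let TD pi pi' : T (pi + pi') = T pi + T pi'.
Proof.
apply/funext => i; rewrite vDE /T -[pi]scale1r measure_conv_linr// !scale1r.
by rewrite opprD addrACA.
Qed.

Let TZ (a : R) pi : T ((a%:C)%C *: pi) = a *: T pi.
Proof.
apply/funext => i; rewrite vZE /T -[X in measure_conv _ _ X]addr0 measure_conv_linr//.
by rewrite measure_conv0r// addr0 scalerBr.
Qed.

Let N_ge0 v : 0 <= N v.
Proof. by apply: sumr_ge0 => i _; exact: tvnorm_ge0. Qed.

Let ND u v : N (u + v) <= N u + N v.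
Proof. by rewrite /N -big_split /=; apply: ler_sum => i _; exact: tvnormD. Qed.

Let NZ (a : R) v : 0 <= a -> N (a *: v) <= a * N v.
Proof.
move=> a0; rewrite /N mulr_sumr; apply: ler_sum => i _.
apply: le_trans (tvnormZ _ _) _.
by rewrite [normc _]normc_real ger0_norm.
Qed.

Let NN v : N (- v) = N v.
Proof.
apply: eq_bigr => i _; apply/eqP; rewrite eq_le tvnormN/=.
by rewrite -[X in tvnorm X <= _]opprK; exact: tvnormN.
Qed.

(** The hypothesis [far], made homogeneous by normalizing [pi] to total mass 1. *)
Let T_far pi : positive_measure pi -> e * tvnorm pi <= N (T pi).
Proof.
move=> ppi; have := tvnorm_ge0 pi; rewrite le_eqVlt => /predU1P[<-|pi0].
  by rewrite mulr0; exact: N_ge0.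
have [j] := far (M0_normalize ppi pi0).
have -> : measure_conv mul (th j) (((tvnorm pi)^-1)%:C%C *: pi) - ((tvnorm pi)^-1)%:C%C *: pi
   = ((tvnorm pi)^-1 *: T pi) j by rewrite -TZ.
rewrite vZE => /le_trans/(_ (tvnormZ _ _)).
rewrite [normc _]normc_real ger0_norm ?invr_ge0 ?tvnorm_ge0// ler_pdivlMl//.
rewrite mulrC => /le_trans; apply.
by rewrite /N (bigD1 j)//= lerDl sumr_ge0// => k _; exact: tvnorm_ge0.
Qed.

(** [pi] ranges over the whole cone of positive measures and not over [M0]: the cone is stable under
    sums and positive multiples, and on it [tvnorm] is additive, so near-optimal [pi] for u and v
    add up to one for u + v. *)
Let E (v : V) := [set N (v + T pi) - e * tvnorm pi | pi in @positive_measure R S].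
(* [p] is sublinear because [T pi] is uniformly far from 0; a linear [F <= p] satisfies
   [F (- T pi) <= - e * tvnorm pi], so that it separates the [T pi] from 0. *)
Let p (v : V) : R := inf (E v).

Let hasE v : has_inf (E v).
Proof.
split; first by eexists; exists 0; [exact: positive_measure0|reflexivity].
exists (- N v) => _ [pi ppi <-].
have := ND (v + T pi) (- v); rewrite NN addrAC subrr add0r.
by have := T_far ppi; lra.
Qed.

Let p_le v pi : positive_measure pi -> p v <= N (v + T pi) - e * tvnorm pi.
Proof. by move=> ppi; apply: ge_inf; [case: (hasE v)|exists pi]. Qed.

Let le_p v x : (forall pi, positive_measure pi -> x <= N (v + T pi) - e * tvnorm pi) ->
  x <= p v.
Proof. by move=> h; apply: lb_le_inf; [case: (hasE v)|move=> _ [pi /h ? <-]]. Qed.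

Let pD u v : p (u + v) <= p u + p v.
Proof.
rewrite -lerBlDl; apply: le_p => pi' ppi'; rewrite lerBlDl -lerBlDr; apply: le_p => pi ppi.
have := p_le (u + v) (positiveD ppi ppi').
rewrite tvnorm_positiveD// TD addrACA => h.
by have := ND (u + T pi) (v + T pi'); lra.
Qed.

Let pZ_le (a : R) v : 0 < a -> p (a *: v) <= a * p v.
Proof.
move=> a0; rewrite -ler_pdivrMl//; apply: le_p => pi ppi; rewrite ler_pdivrMl//.
have := p_le (a *: v) (positive_measureZ (ltW a0) ppi).
rewrite (tvnorm_positiveZ (ltW a0) ppi) TZ -scalerDr => h.
by have := NZ (v + T pi) (ltW a0); lra.
Qed.

Let pZ (a : R) v : 0 < a -> p (a *: v) = a * p v.
Proof.
move=> a0; apply/eqP; rewrite eq_le pZ_le//=.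
have ia0 : 0 < a^-1 by rewrite invr_gt0.
have va : v = a^-1 *: (a *: v) by rewrite scalerA mulVf ?gt_eqF// scale1r.
rewrite -ler_pdivlMl// {1}va; exact: pZ_le.
Qed.

(** A linear F below [p] is also below [N] (take pi = 0), so its restriction to each coordinate is
    bounded and can be complexified. Taking pi = la in p (- T la) gives F (T la) >= e * tvnorm la,
    and F (T la) is the sum over the coordinates. *)
Lemma separating_functionals : exists f : 'I_n -> cmeasure R S -> R[i],
  (forall i, Mdual (f i)) /\ forall la, positive_measure la ->
    ((e * tvnorm la)%:C)%C <= \sum_i (f i (measure_conv mul (th i) la) - f i la).
Proof.
have [F [Flin Fp]] := hahn_banach pD pZ.
have FN v : F v <= N v.
  apply: le_trans (Fp v) _; have := p_le v positive_measure0.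
  rewrite tvnorm0 mulr0 subr0; suff -> : T 0 = 0 by rewrite addr0.
  by apply/funext => i; rewrite /T measure_conv0r// subr0.
have F0 : F 0 = 0 by have := Flin (-1) 0 0; rewrite scaler0 addr0; lra.
have addF u v : F (u + v) = F u + F v by have := Flin 1 u v; rewrite scale1r mul1r.
have oppF v : F (- v) = - F v by have := Flin (-1) v 0; rewrite scaleN1r !addr0 F0; lra.
pose d i mu : V := fun j => if j == i then mu else 0.
have dlin i (a : R) mu nu : d i ((a%:C)%C *: mu + nu) = a *: d i mu + d i nu.
  by apply/funext => j; rewrite vDE vZE /d; case: eqP; rewrite // scaler0 addr0.
have Nd i mu : N (d i mu) = tvnorm mu.
  rewrite /N (bigD1 i)//= /d eqxx big1 ?addr0// => j /negbTE ->.
  exact: tvnorm0.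
have FdC i mu : `|F (d i mu)| <= 1 * tvnorm mu.
  rewrite mul1r ler_norml; have := FN (d i mu); have := FN (- d i mu).
  by rewrite NN oppF Nd => h1 h2; apply/andP; split; lra.
have Fdlin i (a : R) mu nu : F (d i ((a%:C)%C *: mu + nu)) = a * F (d i mu) + F (d i nu).
  by rewrite dlin Flin.
have /choice[f fP] : forall i, exists f, Mdual f /\
    forall mu, positive_measure mu -> f mu = Complex (F (d i mu)) 0.
  move=> i; have [f fd fE] := Mdual_of_real hS (Fdlin i) (FdC i) ler01.
  by exists f.
exists f; split => [i|la pla]; first by have [] := fP i.
have -> : \sum_i (f i (measure_conv mul (th i) la) - f i la) = Complex (F (T la)) 0.
  have -> : F (T la) = \sum_i F (d i (T la i)).
    rewrite -(big_morph F addF F0); congr F; apply/funext => j.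
    have -> : (\sum_i d i (T la i)) j = \sum_i (d i (T la i)) j.
      by elim/big_ind2 : _ => // x1 x2 y1 y2 <- <-.
    by rewrite (bigD1 j)//= /d eqxx big1 ?addr0// => i /negbTE; rewrite eq_sym => ->.
  rewrite -[RHS]/((\sum_i F (d i (T la i)))%:C)%C rmorph_sum; apply: eq_bigr => i _.
  have [_ fE] := fP i.
  (* [f i] is known to agree with F only on positive measures, hence is evaluated at th_i * la and
     at la apart, not at their difference. *)
  have [pc _] := measure_conv_positive hS lcS sc (proj1 (thM0 i)) pla.
  rewrite !fE//; have -> : F (d i (T la i)) = F (d i (measure_conv mul (th i) la)) - F (d i la).
    have := Fdlin i (-1) la (measure_conv mul (th i) la).
    have -> : ((-1)%:C)%C = -1 :> R[i] by apply/eqP; rewrite eq_complex /= oppr0 !eqxx.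
    by rewrite scaleN1r mulN1r addrC [RHS]addrC.
  by apply/eqP; rewrite eq_complex /= subrr !eqxx.
rewrite lecE /= eqxx /=.
have := le_trans (Fp _) (p_le (- T la) pla).
by rewrite oppF addNr /N big1 => [|i _]; [lra|exact: tvnorm0].
Qed.

End separation.

(** Otherwise some finite family and some e leave every [la] in [M0] far from invariant. With the
    separating f_i, the functional h = sum (f_i th_i - f_i) satisfies h - e 1 >= 0, while M h = 0 by
    invariance and M 1 = 1: this gives 0 <= - e. *)
Lemma almost_invariant_of_mean (M : (cmeasure R S -> R[i]) -> R[i]) :
  is_mean M -> topologically_left_invariant mul M -> almost_invariant R mul.
Proof.
move=> [[Mlin _] Mpos M1] Minv s e sM0 e0; apply: contrapT => nex.
pose th (i : 'I_(size s)) := nth 0 s i.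
have thM0 i : M0 (th i) by apply: sM0; exact: mem_nth.
have [|f [df fe]] := @separating_functionals _ th e thM0.
  move=> la M0la; apply: contrapT => nle; apply: nex; exists la => // t ts.
  rewrite ltNge; apply/negP => et; apply: nle.
  have it : (index t s < size s)%N by rewrite index_mem.
  by exists (Ordinal it); rewrite /th /= nth_index.
(* Indexed by a list, since [M] is linear only for combinations of two members of [Mdual]:
   membership and the value of [M] are carried along by induction. *)
pose h (r : seq 'I_(size s)) (la : cmeasure R S) :=
  \sum_(i <- r) (f i (measure_conv mul (th i) la) - f i la).
have hP r : Mdual (h r) /\ M (h r) = 0.
  elim: r => [|i r [dr Mr]].
    have -> : h [::] = fun=> 0 by apply/funext => la; rewrite /h big_nil.
    split; first exact: Mdual0.
    have := Mlin (-1) _ _ Mdual0 Mdual0.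
    have -> : (fun _ : cmeasure R S => -1 * 0 + 0 : R[i]) = fun=> 0.
      by apply/funext => la; rewrite mulr0 addr0.
    by rewrite mulN1r addNr.
  have -> : h (i :: r) = fun la => 1 * functional_act mul (f i) (th i) la +
      (-1 * f i la + h r la).
    apply/funext => la.
    rewrite /h big_cons.
    rewrite /functional_act.
    rewrite mul1r.
    rewrite -addrA; congr (_ + _).
    by rewrite mulN1r.
  have dact := Mdual_act (thM0 i) (df i).
  have dl := Mdual_lin (-1) (df i) dr.
  split; first exact: Mdual_lin.
  by rewrite !Mlin// Minv// Mr mul1r mulN1r addr0 subrr.
have [dh Mh] := hP (index_enum _).
have := Mpos _ (Mdual_lin (- (e%:C)%C) Mdual_one dh).
rewrite Mlin//; last exact: Mdual_one.
rewrite M1 Mh mulr1 addr0 => H.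
have : 0 <= - (e%:C)%C.
  apply: H => la pla; have := fe la pla.
  have E : - (e%:C)%C * Complex (tvnorm la) 0 = - ((e * tvnorm la)%:C)%C.
    by apply/eqP; rewrite eq_complex /=; apply/andP; split; apply/eqP; ring.
  by rewrite /one_functional (positive_tvnorm hS pla) E addrC subr_ge0.
by rewrite oppr_ge0 lecE /= => /andP[_]; rewrite leNgt e0.
Qed.

(** On each th in [M0], th * la - la is small and th has mass 1; by linearity mu * la is close to
    mu(S) la. The list holds the members of [M0] of which mu is a combination, and [K] adds up the
    moduli of the coefficients. *)
Lemma almost_invariant_approx mu : exists (s : seq (cmeasure R S)) (K : R),
  [/\ forall th, th \in s -> M0 th, 0 <= K & forall la e, M0 la -> 0 <= e ->
   (forall th, th \in s -> tvnorm (measure_conv mul th la - la) <= e) ->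
   tvnorm (measure_conv mul mu la - mu setT *: la) <= K * e].
Proof.
elim/(@cmeasure_ind R S hS) : mu => [a mu nu [s [K [sM K0 sP]]] [s' [K' [sM' K0' sP']]]|q rq].
  have na := normc_ge0 a.
  exists (s ++ s'), (normc a * K + K'); split.
  - by move=> th; rewrite mem_cat => /orP[/sM|/sM'].
  - by rewrite addr_ge0// mulr_ge0.
  move=> la e M0la e0 h.
  rewrite measure_conv_linl// cmeasure_linE scalerDl opprD addrACA -scalerA -scalerBr.
  apply: le_trans (tvnorm_lin _ _ _) _; rewrite mulrDl -mulrA; apply: lerD.
    by apply: ler_wpM2l => //; apply: sP => // th ths; apply: h; rewrite mem_cat ths.
  by apply: sP' => // th ths; apply: h; rewrite mem_cat ths orbT.
set mu := cm hS rq; have pmu : positive_measure mu by exact: positive_cm.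
(* A positive measure of mass 0 cannot be normalized, but then its convolution with [la] has norm 0
   and the empty list suffices. *)
have := tvnorm_ge0 mu; rewrite le_eqVlt => /predU1P[m0|m0].
  exists [::], 0; split => // la e M0la _ _.
  have [_ t0] := measure_conv_positive hS lcS sc pmu (proj1 M0la).
  rewrite (positive_tvnorm hS pmu) -m0 scale0r subr0 t0 -m0 !mul0r//.
pose th := (((tvnorm mu)^-1)%:C)%C *: mu.
exists [:: th], (tvnorm mu); split; [|exact: ltW|].
  by move=> t; rewrite inE => /eqP ->; exact: M0_normalize.
move=> la e M0la e00 /(_ th (mem_head _ _)) h.
have -> : measure_conv mul mu la - mu setT *: la =
    ((tvnorm mu)%:C)%C *: (measure_conv mul th la - la).
  rewrite (positive_tvnorm hS pmu) scalerBr; congr (_ - _).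
  have muE : mu = ((tvnorm mu)%:C)%C *: th + 0.
    by rewrite addr0 /th scalerA -rmorphM mulfV ?gt_eqF// scale1r.
  by rewrite {1}muE measure_conv_linl// measure_conv0l// !addr0.
apply: le_trans (tvnormZ _ _) _.
by rewrite [normc _]normc_real gtr0_norm// ler_pM2l.
Qed.

Lemma inf_of_almost_invariant : almost_invariant R mul ->
  forall (n : nat) (mus : 'I_n -> cmeasure R S), (0 < n)%N ->
      inf [set sup [set tvnorm (measure_conv mul (mus i) mu) | i in [set: 'I_n]]
             | mu in @M0 R S]
      <= sup [set normc (mus i setT) | i in [set: 'I_n]].
Proof.
move=> ai n mus n0; apply/ler_addgt0Pr => eps eps0.
have /choice[sK sKP] : forall i, exists sK : seq (cmeasure R S) * R,
    [/\ forall th, th \in sK.1 -> M0 th, 0 <= sK.2 & forall la e, M0 la -> 0 <= e ->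
   (forall th, th \in sK.1 -> tvnorm (measure_conv mul th la - la) <= e) ->
   tvnorm (measure_conv mul (mus i) la - mus i setT *: la) <= sK.2 * e].
  by move=> i; have [s [K h]] := almost_invariant_approx (mus i); exists (s, K).
pose K := \sum_i (sK i).2.
have K0 : 0 <= K by apply: sumr_ge0 => i _; have [] := sKP i.
(* [K] dominates the constant of every [mus i], so each mus_i * la is within eps of mus_i(S) la,
   whose norm is at most the modulus of mus_i(S). *)
pose e := eps / (K + 1).
have e0 : 0 < e by rewrite divr_gt0//; lra.
have [|la M0la laP] := ai (flatten [seq (sK i).1 | i <- enum 'I_n]) e _ e0.
  by move=> th /flatten_mapP[i _]; have [+ _ _] := sKP i; exact.
apply: le_trans (_ : sup [set tvnorm (measure_conv mul (mus i) la) | i in [set: 'I_n]] <= _).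
  apply: ge_inf; last by exists la.
  exists 0 => _ [nu _ <-]; apply: le_trans (le_sup_ord _ (Ordinal n0)).
  exact: tvnorm_ge0.
apply: sup_ord_le => // i; have [_ Ki0 h] := sKP i.
have h1 : tvnorm (measure_conv mul (mus i) la - mus i setT *: la) <= (sK i).2 * e.
  apply: h => //; first exact: ltW.
  move=> th ths; apply: ltW; apply: laP; apply/flatten_mapP; exists i => //.
  by rewrite mem_enum.
have h2 : (sK i).2 * e <= eps.
  apply: (@le_trans _ _ (K * e)).
    apply: ler_wpM2r; first exact: ltW.
    rewrite /K (bigD1 i)//= lerDl sumr_ge0// => j _.
    by have [] := sKP j.
  rewrite /e mulrCA; apply: ler_piMr; first exact: ltW.
  by rewrite ler_pdivrMr; lra.
have h3 : tvnorm (mus i setT *: la) <= normc (mus i setT).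
  by apply: le_trans (tvnormZ _ _) _; rewrite (M0_tvnorm hS M0la) mulr1.
have h4 := le_sup_ord (fun i => normc (mus i setT)) i.
have := tvnormD (measure_conv mul (mus i) la - mus i setT *: la) (mus i setT *: la).
rewrite subrK; lra.
Qed.

End almost_invariant_of_mean.

Unset Implicit Arguments.

Theorem theorem1 (R : realType) (S : ptopologicalType)
    (mul : S -> S -> S) (e : S)
    (hausdorffS : hausdorff_space S)
    (lcS : locally_compact [set: S])
    (mulA : associative mul)
    (mul1s : left_id e mul)
    (muls1 : right_id e mul)
    (mul_sepcont : separately_continuous mul)
    (semifoundS : semifoundation R hausdorffS mul) :
  (exists M : (cmeasure R S -> R[i]) -> R[i],
      is_mean M /\ topologically_left_invariant mul M)
  <->
  (forall (n : nat) (mus : 'I_n -> cmeasure R S), (0 < n)%N ->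
      inf [set sup [set tvnorm (measure_conv mul (mus i) mu) | i in [set: 'I_n]]
             | mu in @M0 R S]
      <= sup [set normc (mus i setT) | i in [set: 'I_n]]).
Proof.
split=> [[M [meanM invM]]|H].
  exact: inf_of_almost_invariant (almost_invariant_of_mean hausdorffS lcS mul_sepcont meanM invM).
apply: invariant_mean_of_almost => //.
exact: almost_invariant_of_inf mul1s H.
Qed.
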